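(* Let $S$ and $R$ be finite-dimensional real Hilbert spaces, with coordinate isomorphism $D_S : S \to \mathbb{R}^{N_S}$, $N_S=\dim S$, with respect to a fixed basis of $S$, and let $T : S\to R$ be a linear operator of rank $N_T\ge 1$. Let $\mathrm{tol}>0$, let $n_t\ge 1$ be an integer, let $\varepsilon_{\mathrm{algofail}}\in(0,1)$, and set $\varepsilon_{\mathrm{testfail}} := \varepsilon_{\mathrm{algofail}}/N_T$. Let $R^{n}$ be the (random) space returned by the Adaptive Randomized Range Approximation algorithm with input $T$, $\mathrm{tol}$, $n_t$, $\varepsilon_{\mathrm{algofail}}$ (described in the context), and let $P_{R^n}$ be the orthogonal projection of $R$ onto $R^n$. Then the failure probability of the whole algorithm satisfies $$ P\big(\|T-P_{R^n}T\| > \mathrm{tol}\big) \le N_T\,\varepsilon_{\mathrm{testfail}} = \varepsilon_{\mathrm{algofail}}. $$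
   Context: A random normal vector in $\mathbb{R}^{N_S}$ is a vector whose entries are independent standard normal (mean $0$, variance $1$) random variables. The coordinate isomorphism $D_S$ maps an element of $S$ to its coefficient vector in the fixed basis; $\underline{M}_S$ is the Gram matrix of $S$ in that basis, i.e. $(v,w)_S = (D_S v)^T\underline{M}_S(D_S w)$, and $\lambda^{\underline{M}_S}_{\min}$ is its smallest eigenvalue. The norm of an operator $O:S\to R$ is $\|O\|=\sup_{0\ne\xi\in S}\|O\xi\|_R/\|\xi\|_S$. Adaptive Randomized Range Approximation algorithm: set $$c_{\mathrm{est}} := \left[\sqrt{2\lambda^{\underline{M}_S}_{\min}}\ \operatorname{erf}^{-1}\!\left(\sqrt[n_t]{\varepsilon_{\mathrm{testfail}}}\right)\right]^{-1},$$ where $\operatorname{erf}(x)=\frac{2}{\sqrt{\pi}}\int_0^x e^{-t^2}\,dt$ is the error function. Draw random normal vectors $\underline{r}_1,\dots,\underline{r}_{n_t}$ (used for testing, kept fixed throughout) and, one per iteration, random normal vectors $\underline{s}_1,\underline{s}_2,\dots$ (used for the basis), all of them mutually independent. Start with $n=0$ and $R^0=\{0\}$. While $$c_{\mathrm{est}}\max_{i=1,\dots,n_t}\big\|(T-P_{R^n}T)D_S^{-1}\underline{r}_i\big\|_R > \mathrm{tol},$$ replace $n$ by $n+1$ and set $R^{n} := \operatorname{span}\{T D_S^{-1}\underline{s}_1,\dots,T D_S^{-1}\underline{s}_{n}\}$. When the loop condition fails, return $R^n$. (Computations are in exact arithmetic.) *)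

(* Defs.v *)
From HB Require Import structures.
From mathcomp Require Import all_boot all_order all_algebra.
From mathcomp Require Import all_classical all_reals all_analysis.

Set Implicit Arguments.
Unset Strict Implicit.
Unset Printing Implicit Defensive.

Import Order.TTheory GRing.Theory Num.Theory.
Import numFieldNormedType.Exports.

Local Open Scope classical_set_scope.
Local Open Scope ring_scope.

(* A finite-dimensional real Hilbert space is a vectType over a realType K
   together with a positive definite symmetric form; completeness is automatic
   in finite dimension. *)

Section hilbert.
Context {K : realType}.

Definition hnorm (V : vectType K) (dV : {dot V for idfun}) (x : V) : K :=
  Num.sqrt (dV x x).

(* The projection onto W along the orthogonal complement of W. *)
Definition orthproj (V : vectType K) (dV : {dot V for idfun})
    (W : {vspace V}) : 'End(V) :=
  daddv_pi W (orthov dV W).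

(* The supremum ranges over a set that is bounded in finite dimension, and
   nonempty as soon as the domain is not the zero space. *)
Definition opnorm (U V : vectType K) (dU : {dot U for idfun})
    (dV : {dot V for idfun}) (O : 'Hom(U, V)) : K :=
  sup [set hnorm dV (O x) / hnorm dU x | x in [set x : U | x != 0]].

Definition gram (V : vectType K) (dV : {dot V for idfun})
    (b : (\dim {:V}).-tuple V) : 'M[K]_(\dim {:V}) :=
  \matrix_(i, j) dV b`_i b`_j.

(* For a symmetric matrix of positive size the set of eigenvalues is finite and
   nonempty, so that this infimum is a minimum. *)
Definition lambda_min (n : nat) (M : 'M[K]_n) : K :=
  inf [set a | eigenvalue M a].

(* The inverse D^-1 of the coordinate isomorphism of the basis b. *)
Definition of_coords (V : vectType K) (b : (\dim {:V}).-tuple V)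
    (x : (\dim {:V}).-tuple K) : V :=
  passmx.vecof b (\row_i tnth x i).

End hilbert.

Section error_function.
Context {K : realType}.

(* The integral from 0 to x is oriented: for x < 0 it is the opposite of the
   integral over [x, 0]. *)
Definition erf (x : K) : K :=
  2 / Num.sqrt pi *
  (if 0 <= x then \int[lebesgue_measure]_(t in `[0, x]) expR (- t ^+ 2)
   else - \int[lebesgue_measure]_(t in `[x, 0]) expR (- t ^+ 2)).

(* erf is a bijection from K onto ]-1, 1[, so that for y in ]-1, 1[ the chosen
   value is the only x with erf x = y; the default 0 is for other y. *)
Definition erf_inv (y : K) : K := xget 0 [set x | erf x = y].

End error_function.

Section randomness.
Context d (Omega : measurableType d) {K : realType} (P : probability Omega K).

(* Mutual independence of a family of random elements: the product rule over
   all finite subfamilies. *)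
Definition mutually_independent d' (E : measurableType d') (I : eqType)
    (X : I -> Omega -> E) : Prop :=
  forall (J : seq I) (A : I -> set E), uniq J ->
    (forall i, measurable (A i)) ->
    P (\bigcap_(i in [set` J]) (X i @^-1` A i)) =
    (\prod_(i <- J) P (X i @^-1` A i))%E.

Definition random_normal_vector (n : nat) (v : {RV P >-> n.-tuple K}) : Prop :=
  (forall (j : 'I_n) (A : set K), measurable A ->
     P [set w | A (tnth (v w) j)] = normal_prob 0 1 A) /\
  mutually_independent (fun (j : 'I_n) w => tnth (v w) j).

End randomness.

Section algorithm.
Context {K : realType} (S R : vectType K).
Variables (dS : {dot S for idfun}) (dR : {dot R for idfun}).
Variables (b : (\dim {:S}).-tuple S) (T : 'Hom(S, R)).
Variables (tol : K) (n_t : nat).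

Definition residual (W : {vspace R}) : 'Hom(S, R) :=
  T - (orthproj dR W \o T)%VF.

Definition c_est (eps_testfail : K) : K :=
  (Num.sqrt (2 * lambda_min (gram dS b)) *
   erf_inv (eps_testfail `^ (n_t%:R)^-1))^-1.

(* The next three definitions describe one run of the algorithm, with drawn
   test vectors r and drawn basis vectors s, the latter numbered from 0. *)
Definition range_space (s : nat -> (\dim {:S}).-tuple K) (n : nat) :
    {vspace R} :=
  <<[seq T (of_coords b (s k)) | k <- iota 0 n]>>%VS.

Definition loop_condition (eps_testfail : K)
    (r : 'I_n_t -> (\dim {:S}).-tuple K)
    (s : nat -> (\dim {:S}).-tuple K) (n : nat) : Prop :=
  tol < c_est eps_testfail *
    \big[Num.max/0]_(i < n_t)
      hnorm dR (residual (range_space s n) (of_coords b (r i))).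

Definition returns (eps_algofail : K)
    (r : 'I_n_t -> (\dim {:S}).-tuple K)
    (s : nat -> (\dim {:S}).-tuple K) (W : {vspace R}) : Prop :=
  let eps_testfail := eps_algofail / (\dim (limg T))%:R in
  exists n : nat,
    [/\ forall m : nat, (m < n)%N -> loop_condition eps_testfail r s m,
        ~ loop_condition eps_testfail r s n &
        W = range_space s n].

End algorithm.

(* Main.v *)
Require Import Defs.
From HB Require Import structures.
From mathcomp Require Import all_boot all_order all_algebra.
From mathcomp Require Import all_classical all_reals all_analysis.
From mathcomp Require Import measurable_realfun.
From mathcomp Require Import ring lra.

Set Implicit Arguments.
Unset Strict Implicit.
Unset Printing Implicit Defensive.

Import Order.TTheory GRing.Theory Num.Theory.
Import numFieldNormedType.Exports.

Local Open Scope classical_set_scope.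
Local Open Scope ring_scope.

(** The algorithm fails when it returns a space [W] with [|T - P_W T| > tol], or
    when it never returns.

    Let [W_n] be the span of the first [n] images [T D^-1 s_k].  The draw [s_n] is independent of [W_n], and if [W_n] is not
    yet the range of [T], then [T D^-1 s_n] falls in [W_n] with probability
    zero ([normal_vector_ker_null], [stalls_null]).  So almost surely the
    dimension grows at each step until [W_n] is the range of [T], at the latest
    for [n = N_T] ([range_space_full]); there the residual vanishes and the loop
    stops with a correct answer.  A failure outside this null event is the
    acceptance, at one of the stages [n < N_T], of a space that is not good
    enough ([no_good_return_sub]), and it remains to bound the probability of
    such an acceptance by [eps_testfail] at each stage and to add up.

    At a given stage the test vectors are independent of [W_n], so [W_n] may be
    taken fixed, with [|O| > tol] for the residual [O = T - P_W T]
    ([joint_section_le]).  Take [z] with [|O z| > tol |z|], and let [u] be the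
    unit vector along [O z].  Then [|O D^-1 r|] is at least [|<u, O D^-1 r>|],
    and [<u, O D^-1 r>] is a linear combination of the independent standard
    normal entries of [r], hence normal and centered
    ([normal_linear_combination]).  By the Cauchy-Schwarz inequality and the
    variational description of the least eigenvalue ([min_eigenvalue]) its
    standard deviation is at least [tol sqrt lambda_min], so that one test is
    passed with probability at most [erf (erf^-1 (eps_testfail^(1/n_t)))]
    ([single_test_bound]); the [n_t] tests are independent
    ([all_tests_bound]).

    Measurability is part of the matter, since the event of failure involves
    projections on random subspaces and operator norms.  The Gram-Schmidt
    formula [orth_rest_rcons] writes the former as rational functions of the
    draws, and rational coordinate vectors suffice to test the latter
    ([opnorm_gtP]). *)

(** * Orthogonal projection *)

Section dot_product.
Context {K : realType} (V : vectType K) (dV : {dot V for idfun}).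
Implicit Types (u v w x y : V) (W : {vspace V}) (s : seq V).

Lemma dotC u v : dV u v = dV v u.
Proof. by rewrite hermC expr0 mul1r. Qed.

Lemma dotDr u v w : dV u (v + w) = dV u v + dV u w.
Proof. exact: linearDr. Qed.

Lemma dotZr a u v : dV u (a *: v) = a * dV u v.
Proof. exact: linearZr. Qed.

Lemma dotDl u v w : dV (u + v) w = dV u w + dV v w.
Proof. by rewrite dotC dotDr !(dotC w). Qed.

Lemma dotZl a u v : dV (a *: u) v = a * dV u v.
Proof. by rewrite dotC dotZr dotC. Qed.

Lemma dot0r u : dV u 0 = 0.
Proof. by rewrite -(scale0r 0) dotZr mul0r. Qed.

Lemma dot0l u : dV 0 u = 0.
Proof. by rewrite dotC dot0r. Qed.

Lemma dotNr u v : dV u (- v) = - dV u v.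
Proof. by rewrite -scaleN1r dotZr mulN1r. Qed.

Lemma dotNl u v : dV (- u) v = - dV u v.
Proof. by rewrite dotC dotNr dotC. Qed.

Lemma dot_sumr (I : Type) (r : seq I) (P : pred I) u (F : I -> V) :
  dV u (\sum_(i <- r | P i) F i) = \sum_(i <- r | P i) dV u (F i).
Proof. by apply: (big_morph (dV u)); [exact: dotDr|exact: dot0r]. Qed.

Lemma dot_suml (I : Type) (r : seq I) (P : pred I) u (F : I -> V) :
  dV (\sum_(i <- r | P i) F i) u = \sum_(i <- r | P i) dV (F i) u.
Proof. by rewrite dotC dot_sumr; apply: eq_bigr => i _; exact: dotC. Qed.

Lemma dot_gt0 u : u != 0 -> 0 < dV u u.
Proof. exact: neq0_dnorm_gt0. Qed.

Lemma dot_ge0 u : 0 <= dV u u.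
Proof. by have [->|/dot_gt0/ltW//] := eqVneq u 0; rewrite dot0r. Qed.

Lemma dot_eq0 u : (dV u u == 0) = (u == 0).
Proof.
have [->|u0] := eqVneq u 0; first by rewrite dot0r eqxx.
by rewrite gt_eqF// dot_gt0.
Qed.

(** The same as [mem_orthovP], stated with the projection of [dV] to a function
    that the lemmas above rewrite. *)
Lemma orthP W u :
  reflect {in W, forall v, dV u v = 0} (u \in orthov dV W).
Proof. exact: mem_orthovP. Qed.

Lemma hnorm_ge0 u : 0 <= hnorm dV u.
Proof. exact: sqrtr_ge0. Qed.

Lemma sqr_hnorm u : hnorm dV u ^+ 2 = dV u u.
Proof. by rewrite sqr_sqrtr// dot_ge0. Qed.

Lemma hnorm0 : hnorm dV 0 = 0.
Proof. by rewrite /hnorm dot0r sqrtr0. Qed.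

Lemma hnorm_gt0 u : u != 0 -> 0 < hnorm dV u.
Proof. by move=> u0; rewrite sqrtr_gt0 dot_gt0. Qed.

(** The square norm of [<u, u> v - <u, v> u] is nonnegative. *)
Lemma dot_cauchy_schwarz u v : `|dV u v| <= hnorm dV u * hnorm dV v.
Proof.
rewrite -(@ler_pXn2r _ 2)// ?nnegrE ?mulr_ge0 ?hnorm_ge0//.
rewrite exprMn !sqr_hnorm -normrX ger0_norm ?sqr_ge0//.
have [->|u0] := eqVneq u 0; first by rewrite !dot0l mul0r expr2 mul0r.
have uu := dot_gt0 u0.
have := dot_ge0 (dV u u *: v - dV u v *: u).
rewrite dotDl !dotDr !(dotNl, dotNr, dotZl, dotZr) (dotC v u).
set a := dV u u; set b := dV u v; set c := dV v v => h.
rewrite -subr_ge0 -(pmulr_rge0 _ uu); apply: le_trans h _.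
by rewrite le_eqVlt; apply/orP; left; apply/eqP; rewrite -/a; ring.
Qed.

(** The component of [y] orthogonal to [W]. *)
Definition orth_rest W y := y - orthproj dV W y.

(** Gram-Schmidt: if [y - p] and [v - q] are orthogonal to the span of [s],
    then [y] minus its projection to the span of [s] and [v] is [y - p] minus
    its projection to the line of [v - q]; the formula is also right for
    [v - q = 0], as [0^-1 = 0]. *)
Lemma orth_step s v y p q : p \in << s >>%VS -> q \in << s >>%VS ->
    y - p \in orthov dV << s >>%VS -> v - q \in orthov dV << s >>%VS ->
  let a := dV (y - p) (v - q) / dV (v - q) (v - q) in
  (p + a *: (v - q) \in << rcons s v >>%VS) /\
  (y - (p + a *: (v - q)) \in orthov dV << rcons s v >>%VS).
Proof.
move=> ps qs yp vq a.
have sub : (<< s >> <= << rcons s v >>)%VS.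
  by apply: sub_span => x xs; rewrite mem_rcons in_cons xs orbT.
have vin : v \in << rcons s v >>%VS.
  by apply: memv_span; rewrite mem_rcons mem_head.
split.
  apply: rpredD; first exact: (subvP sub).
  by apply: rpredZ; apply: rpredB => //; exact: (subvP sub).
rewrite opprD addrA; set z := _ - a *: _.
have zs : {in << s >>%VS, forall w, dV z w = 0}.
  move=> w ws; rewrite dotDl dotNl dotZl.
  by rewrite (orthP _ _ yp)// (orthP _ _ vq)// mulr0 subr0.
have zv : dV z v = 0.
  have := dotDr z (v - q) q; rewrite subrK (zs q qs) addr0 => ->.
  rewrite dotDl dotNl dotZl /a.
  have [e|n] := eqVneq (v - q) 0; first by rewrite e !dot0r mulr0 subr0.
  by rewrite divfK ?subrr// dot_eq0.
apply/orthP => w; rewrite -cats1 span_cat => /memv_addP[w1 w1s [w2]].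
rewrite span_seq1 => /vlineP[k ->] ->.
by rewrite dotDr dotZr zv mulr0 addr0 zs.
Qed.

Lemma orth_decomp s y :
  exists2 p, p \in << s >>%VS & y - p \in orthov dV << s >>%VS.
Proof.
elim/last_ind: s y => [|s v IH] y.
  exists 0; first exact: mem0v.
  by apply/orthP => w; rewrite span_nil memv0 => /eqP->; rewrite dot0r.
have [p ps yp] := IH y; have [q qs vq] := IH v.
by have [? ?] := orth_step ps qs yp vq; eexists; eassumption.
Qed.

Lemma orthov_direct W : (W :&: orthov dV W)%VS = 0%VS.
Proof.
apply/eqP; rewrite -subv0; apply/subvP => w; rewrite memv_cap memv0.
by case/andP=> wW /orthP/(_ w wW)/eqP; rewrite dot_eq0.
Qed.

(** The projection along the orthogonal complement is only specified on the sum
    of [W] and its complement; a decomposition of [y] puts [y] in that sum. *)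
Lemma orthproj_unique W y p : p \in W -> y - p \in orthov dV W ->
  orthproj dV W y = p.
Proof.
move=> pW yp; rewrite /orthproj -[y](subrK p) linearD /=.
rewrite [X in _ + X]daddv_pi_id ?orthov_direct//.
have := daddv_pi_add (orthov_direct W) (memv_add pW yp).
rewrite [p + _]addrC subrK -{1}[y](subrK p) linearD /=.
rewrite [daddv_pi W _ p]daddv_pi_id ?orthov_direct//.
set c := daddv_pi W _ (y - p) => e.
have cW : c \in W by exact: memv_pi.
have : c \in orthov dV W.
  have -> : c = y - p - daddv_pi (orthov dV W) W y.
    by apply/esym/eqP; rewrite !subr_eq -{1}e addrAC.
  by rewrite rpredB//; exact: memv_pi.
move=> cO; have : c \in (W :&: orthov dV W)%VS by rewrite memv_cap cW.
by rewrite orthov_direct memv0 => /eqP->; rewrite add0r.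
Qed.

Lemma orthproj_spec W y :
  orthproj dV W y \in W /\ orth_rest W y \in orthov dV W.
Proof.
have [p] := orth_decomp (vbasis W) y.
rewrite (span_basis (vbasisP W)) /orth_rest => pW yp.
by rewrite (orthproj_unique pW yp).
Qed.

Lemma orth_rest_eq0 W y : (orth_rest W y == 0) = (y \in W).
Proof.
have [pW yp] := orthproj_spec W y; rewrite /orth_rest.
apply/eqP/idP => [/eqP|yW]; first by rewrite subr_eq0 => /eqP->.
by rewrite (@orthproj_unique W y y) ?subrr ?mem0v.
Qed.

(** The recursion of Gram-Schmidt: adding one vector to the spanning sequence
    changes the orthogonal component by a formula in scalar products only. *)
Lemma orth_rest_rcons s v y : orth_rest << rcons s v >> y =
  orth_rest << s >> y - (dV (orth_rest << s >> y) (orth_rest << s >> v) /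
    dV (orth_rest << s >> v) (orth_rest << s >> v)) *: orth_rest << s >> v.
Proof.
have [ps yp] := orthproj_spec << s >> y; have [qs vq] := orthproj_spec << s >> v.
have [h1 h2] := orth_step ps qs yp vq.
by rewrite {1}/orth_rest (orthproj_unique h1 h2) opprD addrA.
Qed.

Lemma orth_rest_nil y : orth_rest <<[::]>> y = y.
Proof.
rewrite /orth_rest (@orthproj_unique _ _ 0) ?subr0 ?mem0v//.
by apply/orthP => w; rewrite span_nil memv0 => /eqP->; rewrite dot0r.
Qed.

End dot_product.

(** * The least eigenvalue of a symmetric matrix *)

Section rayleigh.
Context {K : realType}.

Definition qform n (M : 'M[K]_n) (x y : 'rV[K]_n) : K :=
  \sum_i \sum_j x 0 i * M i j * y 0 j.

Lemma qform_mulmx n (M : 'M[K]_n) x y :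
  qform M x y = (x *m M *m y^T) 0 0.
Proof.
rewrite /qform mxE exchange_big /=; apply: eq_bigr => j _.
by rewrite !mxE big_distrl.
Qed.

Lemma qformDl n (M : 'M[K]_n) x y z :
  qform M (x + y) z = qform M x z + qform M y z.
Proof. by rewrite !qform_mulmx !mulmxDl mxE. Qed.

Lemma qformDr n (M : 'M[K]_n) x y z :
  qform M z (x + y) = qform M z x + qform M z y.
Proof. by rewrite !qform_mulmx linearD mulmxDr mxE. Qed.

Lemma qformZl n (M : 'M[K]_n) a x y : qform M (a *: x) y = a * qform M x y.
Proof. by rewrite !qform_mulmx -!scalemxAl mxE. Qed.

Lemma qformZr n (M : 'M[K]_n) a x y : qform M x (a *: y) = a * qform M x y.
Proof. by rewrite !qform_mulmx linearZ -scalemxAr mxE. Qed.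

Lemma qformC n (M : 'M[K]_n) x y : M^T = M -> qform M x y = qform M y x.
Proof.
move=> Ms; rewrite /qform exchange_big; apply: eq_bigr => i _.
apply: eq_bigr => j _; rewrite -{1}Ms mxE; ring.
Qed.

Lemma qform1 n (x : 'rV[K]_n) : qform 1%:M x x = \sum_i x 0 i ^+ 2.
Proof.
rewrite qform_mulmx mulmx1 mxE; apply: eq_bigr => i _.
by rewrite mxE expr2.
Qed.

Lemma qform1_ge0 n (x : 'rV[K]_n) : 0 <= qform 1%:M x x.
Proof. by rewrite qform1 sumr_ge0// => i _; rewrite sqr_ge0. Qed.

Lemma qform1_gt0 n (x : 'rV[K]_n) : x != 0 -> 0 < qform 1%:M x x.
Proof.
move=> x0; rewrite lt_neqAle qform1_ge0 andbT eq_sym; apply: contraNN x0.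
rewrite qform1 psumr_eq0; last by move=> i _; rewrite sqr_ge0.
move=> /allP h; apply/eqP/rowP => i; rewrite mxE; apply/eqP.
by rewrite -sqrf_eq0; apply: h; rewrite mem_index_enum.
Qed.

(** With [X] and [B] the sums of the [x j ^+ 2] and of the [a j * x j], the sum
    of the squares of the [X a j - B x j] is nonnegative. *)
Lemma sum_cauchy_schwarz n (a x : 'I_n -> K) :
  (\sum_j a j * x j) ^+ 2 <= (\sum_j a j ^+ 2) * (\sum_j x j ^+ 2).
Proof.
set B := \sum_j a j * x j; set A := \sum_j a j ^+ 2; set X := \sum_j x j ^+ 2.
have X0 : 0 <= X by apply: sumr_ge0 => j _; exact: sqr_ge0.
have [X0'|X0'] := eqVneq X 0.
  have x0 j : x j = 0.
    move/eqP: X0'; rewrite psumr_eq0; last by move=> k _; exact: sqr_ge0.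
    by move=> /allP/(_ j (mem_index_enum _)); rewrite sqrf_eq0 => /eqP.
  by rewrite X0' mulr0 /B big1 ?expr0n// => j _; rewrite x0 mulr0.
have : 0 <= \sum_j (X * a j - B * x j) ^+ 2.
  by apply: sumr_ge0 => j _; exact: sqr_ge0.
have -> : \sum_j (X * a j - B * x j) ^+ 2 =
    X ^+ 2 * A + (B ^+ 2 * X - 2 * X * B * B).
  transitivity (\sum_j X ^+ 2 * a j ^+ 2 +
      (\sum_j B ^+ 2 * x j ^+ 2 - \sum_j 2 * X * B * (a j * x j))).
    by rewrite -sumrB -big_split /=; apply: eq_bigr => j _; ring.
  by rewrite -!big_distrr.
have Xp : 0 < X by rewrite lt_neqAle eq_sym X0'.
move=> h; rewrite -subr_ge0 -(pmulr_rge0 _ Xp); apply: le_trans h _.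
by rewrite le_eqVlt; apply/orP; left; apply/eqP; ring.
Qed.

Lemma continuous_qform n (M : 'M[K]_n) : continuous (fun x => qform M x x).
Proof.
have sumc m (f : 'I_m -> 'rV[K]_n -> K) : (forall i, continuous (f i)) ->
    continuous (fun x => \sum_i f i x).
  by move=> fc; apply: continuous_big => //; exact: add_continuous.
apply: (sumc n) => i; apply: (sumc n) => j x.
have cc k : (fun y : 'rV[K]_n => y 0 k) @ x --> x 0 k.
  exact: coord_continuous.
by apply: (cvgM (cvgM (cc i) (cvg_cst (M i j))) (cc j)).
Qed.

(** At a minimizer [x] of the Rayleigh quotient over the unit sphere, which is
    compact, the first variation vanishes in every direction: this says that
    [x] is an eigenvector for the minimal value. *)
Lemma min_eigenvalue n (M : 'M[K]_n) : (0 < n)%N -> M^T = M ->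
  eigenvalue M (lambda_min M) /\
  forall x, lambda_min M * qform 1%:M x x <= qform M x x.
Proof.
move=> n0 Ms.
pose A := [set x : 'rV[K]_n | qform 1%:M x x = 1].
have cA : compact A.
  apply: (@subclosed_compact _ _
      [set v : 'rV[K]_n | forall i, `[(-1 : K), 1]%classic (v ord0 i)]).
  - rewrite (_ : A = (fun x => qform 1%:M x x) @^-1` [set x | x = 1]); last first.
      by apply/seteqP; split.
    apply: preimage_closed; last exact: closed_eq.
    by move=> ? _; exact: continuous_qform.
  - by apply: (@rV_compact _ _ (fun=> `[(-1 : K), 1]%classic)) => _;
      exact: segment_compact.
  - move=> v; rewrite /A /= qform1 => v1 i.
    rewrite in_itv /= -ler_norml -(@ler_pXn2r _ 2)// ?nnegrE//.
    rewrite expr1n -normrX ger0_norm ?sqr_ge0// -v1 (bigD1 i)//= lerDl.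
    by apply: sumr_ge0 => j _; rewrite sqr_ge0.
have A0 : A !=set0.
  exists (delta_mx 0 (Ordinal n0)); rewrite /A /= qform1 (bigD1 (Ordinal n0))//=.
  rewrite mxE !eqxx expr1n big1 ?addr0// => i iN.
  by rewrite mxE (negbTE iN) expr0n.
have [x0 /set_mem x0A x0min] := EVT_min_rV A0 cA
  (continuous_subspaceT (@continuous_qform n M)).
pose m := qform M x0 x0.
have mle x : m * qform 1%:M x x <= qform M x x.
  have [->|xn0] := eqVneq x 0.
    by rewrite !qform_mulmx !mul0mx mxE mulr0.
  pose c := Num.sqrt (qform 1%:M x x).
  have c0 : 0 < c by rewrite sqrtr_gt0 qform1_gt0.
  have cE : qform 1%:M x x = c * c by rewrite -expr2 sqr_sqrtr// qform1_ge0.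
  have : m <= qform M (c^-1 *: x) (c^-1 *: x).
    apply: x0min; rewrite inE /A /= qformZl qformZr cE.
    by rewrite mulrA -invfM mulVf// mulf_neq0// gt_eqF.
  rewrite qformZl qformZr mulrA -invfM mulrC ler_pdivlMr ?mulr_gt0//.
  by rewrite cE.
have x0n : x0 != 0.
  apply: contra_eq_neq x0A => ->.
  by rewrite qform_mulmx !mul0mx mxE eq_sym oner_eq0.
have first_variation y : qform M x0 y = m * qform 1%:M x0 y.
  set u := qform M x0 y - m * qform 1%:M x0 y.
  suff : u = 0 by move/eqP; rewrite subr_eq0 => /eqP.
  pose c := qform M y y - m * qform 1%:M y y.
  have h t : 0 <= t * (u *+ 2) + t ^+ 2 * c.
    have := mle (x0 + t *: y).
    rewrite !(qformDl, qformDr, qformZl, qformZr).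
    rewrite (qformC y x0 Ms) (@qformC _ _ y x0 (tr_scalar_mx _ _)).
    rewrite [qform 1%:M x0 x0]x0A -/m -subr_ge0 => /le_trans; apply.
    by rewrite /u /c le_eqVlt; apply/orP; left; apply/eqP; ring.
  have c0 : 0 <= c by rewrite subr_ge0 mle.
  (* The value at [t = - u / (c + 1)] is negative unless [u] is zero; the [+ 1]
     avoids a division by zero. *)
  have := h (- u / (c + 1)).
  have -> : - u / (c + 1) * (u *+ 2) + (- u / (c + 1)) ^+ 2 * c =
     - (u ^+ 2 * ((c + 2) / (c + 1) ^+ 2)).
    by field; rewrite gt_eqF// ltr_wpDl.
  rewrite oppr_ge0 pmulr_lle0; last first.
    by rewrite divr_gt0// ?exprn_gt0// ltr_wpDl.
  by move=> u2; apply/eqP; rewrite -sqrf_eq0 eq_le u2 sqr_ge0.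
have meig : eigenvalue M m.
  apply/eigenvalueP; exists x0 => //; apply/rowP => j.
  have := first_variation (delta_mx 0 j).
  rewrite !qform_mulmx mulmx1 trmx_delta -!colE.
  by rewrite [LHS]mxE [X in _ = _ * X]mxE => ->; rewrite mxE.
have mlb a : eigenvalue M a -> m <= a.
  move=> /eigenvalueP[v vM vn0]; have := mle v.
  rewrite [leRHS]qform_mulmx vM -scalemxAl mxE -[v in v *m _]mulmx1.
  by rewrite -qform_mulmx ler_pM2r// qform1_gt0.
have -> : lambda_min M = m.
  apply/eqP; rewrite eq_le; apply/andP; split.
    by apply: ge_inf; [exists m => a; exact: mlb|exact: meig].
  by apply: lb_le_inf; [exists m|move=> a; exact: mlb].
by split.
Qed.

End rayleigh.

Section qform_bounds.
Context {K : realType}.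

Lemma qform_le n (N : 'M[K]_n) x :
  qform N x x <= (\sum_i \sum_j `|N i j|) * qform 1%:M x x.
Proof.
rewrite /qform -/(qform N x x) big_distrl; apply: ler_sum => i _ /=.
rewrite big_distrl; apply: ler_sum => j _ /=; rewrite -/(qform 1%:M x x) qform1.
apply: (le_trans (ler_norm _)); rewrite !normrM mulrAC mulrC ler_wpM2l//.
have sq k : `|x 0 k| ^+ 2 <= \sum_l x 0 l ^+ 2.
  rewrite -normrX ger0_norm ?sqr_ge0// (bigD1 k)//= lerDl sumr_ge0// => l _.
  by rewrite sqr_ge0.
have [/ler_wpM2l h|/ltW/ler_wpM2l h] := leP `|x 0 i| `|x 0 j|.
  by apply: le_trans (sq j); rewrite mulrC expr2; apply: h.
by apply: le_trans (sq i); rewrite expr2; apply: h.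
Qed.

(** The positive set of a quadratic form is open, hence meets the dense set of
    rational vectors as soon as it is nonempty. *)
Lemma qform_gt0_rat n (N : 'M[K]_n) x : 0 < qform N x x ->
  exists y : 'rV[rat]_n, 0 < qform N (map_mx ratr y) (map_mx ratr y).
Proof.
move=> qx.
have := @continuous_qform _ n N x [set t | 0 < t].
have /[swap]/[apply] : nbhs (qform N x x) [set t | 0 < t].
  by apply: open_nbhs_nbhs; split => //; exact: open_gt.
case/nbhs_ballP => e /= e0 he.
have dense k : exists q : rat, x 0 k < ratr q < x 0 k + e.
  have /rat_in_itvoo[q] : x 0 k < x 0 k + e.
    by rewrite ltrDl (e0 : 0 < e).
  by rewrite in_itv /=; exists q.
pose y := \row_k projT1 (cid (dense k)).
exists y; apply: (he (map_mx ratr y)); split=> [|i j]; first exact: e0.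
rewrite !mxE (ord1 i); case: cid => q /= /andP[q1 q2].
by rewrite /ball /= distrC gtr0_norm ?subr_gt0// ltrBlDl.
Qed.

End qform_bounds.

(** * Operator norm and Gram matrix in coordinates *)

Section coordinates.
Context {K : realType} (S R : vectType K).
Variables (dS : {dot S for idfun}) (dR : {dot R for idfun}).
Variables (b : (\dim {:S}).-tuple S).
Hypothesis b_basis : basis_of {:S} b.
Hypothesis S_gt0 : (0 < \dim {:S})%N.
Notation vec := (passmx.vecof b).

Lemma lfun_vecof (V : vectType K) (O : 'Hom(S, V)) x :
  O (vec x) = \sum_i x 0 i *: O b`_i.
Proof. by rewrite linear_sum; apply: eq_bigr => i _; rewrite linearZ. Qed.

Lemma vecof_surj v : exists x, v = vec x.
Proof.
exists (\row_i coord b i v); rewrite {1}(coord_basis b_basis (memvf v)).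
by apply: eq_bigr => i _; rewrite mxE.
Qed.

Lemma dot_vecof (V : vectType K) (dV : {dot V for idfun}) (O : 'Hom(S, V)) x :
  dV (O (vec x)) (O (vec x)) = qform (\matrix_(i, j) dV (O b`_i) (O b`_j)) x x.
Proof.
rewrite lfun_vecof dot_suml; apply: eq_bigr => i _.
rewrite dot_sumr; apply: eq_bigr => j _.
by rewrite mxE dotZl dotZr; ring.
Qed.

Lemma gram_vecof x : dS (vec x) (vec x) = qform (gram dS b) x x.
Proof.
rewrite -[vec x]id_lfunE dot_vecof; congr (qform _ x x).
by apply/matrixP => i j; rewrite !mxE !id_lfunE.
Qed.

Lemma trmx_gram : (gram dS b)^T = gram dS b.
Proof. by apply/matrixP => i j; rewrite !mxE dotC. Qed.

Lemma gram_rayleigh x :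
  lambda_min (gram dS b) * qform 1%:M x x <= dS (vec x) (vec x).
Proof. by rewrite gram_vecof; apply: (min_eigenvalue S_gt0 trmx_gram).2. Qed.

Lemma lambda_min_gram_gt0 : 0 < lambda_min (gram dS b).
Proof.
have [/eigenvalueP[x xM x0] _] := min_eigenvalue S_gt0 trmx_gram.
have : 0 < dS (vec x) (vec x) by apply: dot_gt0; rewrite passmx.vecof_eq0.
rewrite gram_vecof qform_mulmx xM -scalemxAl mxE -[x in x *m _]mulmx1.
by rewrite -qform_mulmx pmulr_lgt0// qform1_gt0.
Qed.

(** The supremum in the operator norm is over a bounded set: in coordinates the
    numerator is at most a multiple of the Euclidean norm, and the denominator
    at least a multiple of it by the Rayleigh bound. *)
Lemma opnorm_bound (O : 'Hom(S, R)) :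
  exists C, forall v, v != 0 -> hnorm dR (O v) / hnorm dS v <= C.
Proof.
pose N : 'M[K]_(\dim {:S}) := \matrix_(i, j) dR (O b`_i) (O b`_j).
pose C := (\sum_i \sum_j `|N i j|) / lambda_min (gram dS b).
have l0 := lambda_min_gram_gt0.
have C0 : 0 <= C.
  by rewrite divr_ge0 ?(ltW l0)// sumr_ge0// => i _; rewrite sumr_ge0.
exists (Num.sqrt C) => v v0.
rewrite ler_pdivrMr ?hnorm_gt0// -(@ler_pXn2r _ 2)// ?nnegrE ?hnorm_ge0//.
  rewrite exprMn !sqr_hnorm sqr_sqrtr//.
  have [x ->] := vecof_surj v; rewrite dot_vecof (le_trans (qform_le _ _))//.
  rewrite /C -mulrA ler_wpM2l//.
    by rewrite sumr_ge0// => i _; rewrite sumr_ge0.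
  by rewrite mulrC ler_pdivlMr// mulrC gram_rayleigh.
by rewrite mulr_ge0 ?sqrtr_ge0 ?hnorm_ge0.
Qed.

(** A witness for a large operator norm can be taken with rational coordinates,
    because the condition is the positivity of a quadratic form.  This makes
    [tol < opnorm] a countable union of simpler conditions. *)
Lemma opnorm_gtP (O : 'Hom(S, R)) tol : 0 <= tol ->
  tol < opnorm dS dR O <->
  exists x : 'rV[rat]_(\dim {:S}),
    tol * hnorm dS (vec (map_mx ratr x)) < hnorm dR (O (vec (map_mx ratr x))).
Proof.
move=> tol0; rewrite /opnorm; set A := image _ _.
have quotient v : tol * hnorm dS v < hnorm dR (O v) ->
    v != 0 /\ tol < hnorm dR (O v) / hnorm dS v.
  move=> h; have v0 : v != 0.
    by apply: contraTneq h => ->; rewrite linear0 !hnorm0 mulr0 ltxx.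
  by split=> //; rewrite ltr_pdivlMr ?hnorm_gt0.
split=> [lt|[x /quotient[v0 lt]]]; last first.
  apply: lt_le_trans lt _; apply: ub_le_sup; last by exists (vec (map_mx ratr x)).
  by have [C hC] := opnorm_bound O; exists C => _ [v v1 <-]; exact: hC.
have supA : has_sup A.
  by apply: contraPP lt => /sup_out ->; apply/negP; rewrite -leNgt.
have [_ [v /= v0 <-] {}lt] := sup_gt supA.1 lt.
have {lt} : 0 < dR (O v) (O v) - tol ^+ 2 * dS v v.
  move: lt; rewrite ltr_pdivlMr ?hnorm_gt0// -(@ltr_pXn2r _ 2)//
    ?nnegrE ?mulr_ge0 ?hnorm_ge0//.
  by rewrite exprMn !sqr_hnorm subr_gt0.
have form x : dR (O (vec x)) (O (vec x)) - tol ^+ 2 * dS (vec x) (vec x) =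
    qform ((\matrix_(i, j) dR (O b`_i) (O b`_j)) - tol ^+ 2 *: gram dS b) x x.
  rewrite gram_vecof dot_vecof !qform_mulmx mulmxBr mulmxBl -scalemxAr.
  by rewrite -scalemxAl [RHS]mxE; congr (_ + _); rewrite !mxE.
have [x ->] := vecof_surj v; rewrite form => /qform_gt0_rat[y].
rewrite -form => h; exists y.
rewrite -(@ltr_pXn2r _ 2)// ?nnegrE ?mulr_ge0 ?hnorm_ge0//.
by rewrite exprMn !sqr_hnorm -subr_gt0.
Qed.

Lemma opnorm0 : opnorm dS dR 0 <= 0.
Proof.
rewrite leNgt; apply/negP => /(opnorm_gtP 0 (lexx _))[x].
by rewrite zero_lfunE hnorm0 mul0r ltxx.
Qed.

End coordinates.

(** * Independence of tuples of draws *)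

Section independence.
Context d (Omega : measurableType d) {K : realType} (P : probability Omega K).
Local Open Scope ereal_scope.

(** For a fixed event [C], both [A |-> P (X in A, C)] and
    [A |-> P (X in A) P C] are finite measures, hence they agree as soon as
    they agree on a pi-system that generates. *)
Lemma indep_pi_system d' (E : measurableType d') (X : Omega -> E)
    (G : set (set E)) (C : set Omega) :
  measurable_fun setT X -> measurable C ->
  G `<=` measurable -> measurable `<=` <<s G >> -> setI_closed G -> G setT ->
  (forall A, G A -> P (X @^-1` A `&` C) = P (X @^-1` A) * P C) ->
  forall A, measurable A -> P (X @^-1` A `&` C) = P (X @^-1` A) * P C.
Proof.
move=> mX mC Gm mG GI GT GE A /mG sA.
have c0 : (0 <= fine (P C))%R by rewrite fine_ge0.
pose m1 : {measure set E -> \bar K} := pushforward (mrestr P mC) X.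
pose m2 : {measure set E -> \bar K} := mscale (NngNum c0) (pushforward P X).
have m2E B : m2 mX B = P (X @^-1` B) * P C.
  by rewrite /m2 /= /mscale /= fineK ?fin_num_measure// muleC.
rewrite -m2E -[LHS]/(m1 mX A).
apply: (g_sigma_algebra_measure_unique G Gm (fun=> setT)) => //.
- by rewrite bigcup_const//; exists 0%N.
- by move=> B GB; rewrite m2E -GE.
- by move=> _; rewrite /m1 /= /pushforward /mrestr preimage_setT setTI
    (le_lt_trans (probability_le1 P mC))// ltry.
Qed.

Section sections.
Context d1 d2 (T1 : measurableType d1) (T2 : measurableType d2).
Variables (X1 : {RV P >-> T1}) (X2 : {RV P >-> T2}).
Hypothesis indep12 : forall A B, measurable A -> measurable B ->
  P (X1 @^-1` A `&` X2 @^-1` B) = P (X1 @^-1` A) * P (X2 @^-1` B).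

(** The joint law of independent variables is the product of their laws, and is
    computed by sections. *)
Lemma indep_law (C : set (T1 * T2)) : measurable C ->
  P [set w | C (X1 w, X2 w)] =
    \int[distribution P X1]_x distribution P X2 (xsection C x).
Proof.
move=> mC.
have mX : measurable_fun setT (fun w => (X1 w, X2 w)).
  exact: measurable_fun_pair.
pose m' : {measure set (T1 * T2)%type -> \bar K} :=
  pushforward P (fun w => (X1 w, X2 w)).
transitivity (m' mX C) => //.
by rewrite -(@product_measure_unique _ _ _ _ _ (distribution P X1)
  (distribution P X2)).
Qed.

(** This is how a bound that holds for all fixed values of [X1] is transferred
    to the random value. *)
Lemma indep_section_le (C : set (T1 * T2)) (c : \bar K) : measurable C ->
  (forall x, P [set w | C (x, X2 w)] <= c) -> P [set w | C (X1 w, X2 w)] <= c.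
Proof.
move=> mC h; rewrite indep_law//.
rewrite -[c](@mule1 K) -(probability_setT (distribution P X1)).
rewrite -integral_cst//; apply: ge0_le_integral => //.
- exact: measurable_fun_xsection.
- move=> x _; apply: le_trans (h x); rewrite le_eqVlt; apply/orP; left.
  by apply/eqP; congr (P _); apply/seteqP; split=> w /=; rewrite /xsection /= inE.
Qed.

End sections.

Section joint.
Context d' (E : measurableType d') (I : eqType) (X : I -> Omega -> E).

Definition joint n (J : n.-tuple I) (w : Omega) : n.-tuple E :=
  [tuple X (tnth J k) w | k < n].

Definition box n (J : n.-tuple I) (B : I -> set E) : set (n.-tuple E) :=
  [set t | forall k, B (tnth J k) (tnth t k)].

Definition boxes n (J : n.-tuple I) : set (set (n.-tuple E)) :=
  [set box J B | B in [set B : I -> set E | forall i, measurable (B i)]].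

Lemma measurable_boxes n (J : n.-tuple I) : boxes J `<=` measurable.
Proof.
move=> _ [B /= mB <-].
rewrite (_ : box J B = \bigcap_(k in [set: 'I_n])
    ((fun t => tnth t k) @^-1` B (tnth J k))); last first.
  by apply/seteqP; split=> [t ht k _|t ht k]; [exact: ht|exact: (ht k)].
apply: fin_bigcap_measurable => // k _.
by rewrite -[X in measurable X]setTI; exact: measurable_tnth.
Qed.

(** A condition on a single coordinate is a box whose other sides are the whole
    space; this needs [J] to be without repetition, as the sides of a box are
    indexed by [I] and not by the positions in [J]. *)
Lemma boxes_generate n (J : n.-tuple I) : uniq J ->
  measurable `<=` <<s boxes J >>.
Proof.
move=> uJ; apply: smallest_sub; first exact: smallest_sigma_algebra.
rewrite -bigcup_seq => D [k _ [A mA <-]]; apply: sub_sigma_algebra.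
exists (fun i => if i == tnth J k then A else setT).
  by move=> i /=; case: ifP.
rewrite setTI; apply/seteqP; split=> [t /(_ k)|t At j]; first by rewrite eqxx.
case: ifP => // /eqP jk.
suff -> : j = k by [].
by move/tuple_uniqP : uJ; exact.
Qed.

Lemma boxesI n (J : n.-tuple I) : setI_closed (boxes J).
Proof.
move=> _ _ [B mB <-] [C mC <-]; exists (fun i => B i `&` C i).
  by move=> i; apply: measurableI; [exact: mB|exact: mC].
apply/seteqP; split=> [t h|t [h1 h2] k]; last by split.
by split=> k; have [] := h k.
Qed.

Lemma boxesT n (J : n.-tuple I) : boxes J setT.
Proof. by exists (fun=> setT) => //; apply/seteqP. Qed.

Lemma joint_box n (J : n.-tuple I) B :
  joint J @^-1` box J B = \bigcap_(i in [set` (J : seq I)]) (X i @^-1` B i).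
Proof.
apply/seteqP; split=> w /= h.
  by move=> i /= /tnthP[k ->]; have := h k; rewrite tnth_mktuple.
by move=> k; rewrite tnth_mktuple; apply: h; exact: mem_tnth.
Qed.

Hypothesis mX : forall i, measurable_fun setT (X i).

Lemma measurable_joint n (J : n.-tuple I) : measurable_fun setT (joint J).
Proof.
apply/measurable_fun_tnthP => k.
by apply: (eq_measurable_fun (X (tnth J k))) => // w _; rewrite /= tnth_mktuple.
Qed.

(** The product rule for events is the product rule for boxes; two applications
    of [indep_pi_system] extend it to all measurable sets of tuples. *)
Lemma indep_joint m n (J1 : m.-tuple I) (J2 : n.-tuple I) :
  mutually_independent P X -> uniq (J1 ++ J2) ->
  forall A B, measurable A -> measurable B ->
  P (joint J1 @^-1` A `&` joint J2 @^-1` B) =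
    P (joint J1 @^-1` A) * P (joint J2 @^-1` B).
Proof.
move=> indX u12; have := u12; rewrite cat_uniq => /and3P[u1 u21 u2] A B mA mB.
have mpre k (J : k.-tuple I) D : measurable D -> measurable (joint J @^-1` D).
  by move=> mD; rewrite -[X in measurable X]setTI; exact: measurable_joint.
apply: (indep_pi_system (G := boxes J1)) => //.
- exact: measurable_joint.
- exact: mpre.
- exact: measurable_boxes.
- exact: boxes_generate.
- exact: boxesI.
- exact: boxesT.
move=> {A mA} A bA; have mA := measurable_boxes bA.
rewrite setIC [RHS]muleC.
apply: (indep_pi_system (G := boxes J2)) => //.
- exact: measurable_joint.
- exact: mpre.
- exact: measurable_boxes.
- exact: boxes_generate.
- exact: boxesI.
- exact: boxesT.
move=> {B mB} _ [B2 mB2 <-]; case: bA => B1 mB1 <-.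
rewrite !joint_box (indX J1)// (indX J2)//.
pose B i := if i \in (J1 : seq I) then B1 i else B2 i.
have mB i : measurable (B i) by rewrite /B; case: ifP.
have := indX (J1 ++ J2) B u12 mB.
rewrite big_cat /= muleC => h.
have e1 : \prod_(i <- J1) P (X i @^-1` B i) = \prod_(i <- J1) P (X i @^-1` B1 i).
  by apply: eq_big_seq => i iJ; rewrite /B iJ.
have e2 : \prod_(i <- J2) P (X i @^-1` B i) = \prod_(i <- J2) P (X i @^-1` B2 i).
  apply: eq_big_seq => i iJ; rewrite /B ifN//.
  by apply: contraNN u21 => iJ1; apply/hasP; exists i.
rewrite -e1 -e2 -h; congr (P _).
apply/seteqP; split=> w /= => [[h2 h1] i /= |h0].
  rewrite mem_cat /B; case: ifP => //= iJ1 iJ; last exact: h2.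
  exact: h1.
split=> i /= iJ.
  have := h0 i; rewrite /= mem_cat iJ orbT => /(_ isT); rewrite /B ifN//.
  by apply: contraNN u21 => iJ1; apply/hasP; exists i.
by have := h0 i; rewrite /= mem_cat iJ /B iJ => /(_ isT).
Qed.

(** The form in which independence of the draws is used: a bound that holds
    for all fixed values of the draws in [J1] also holds for the random ones. *)
Lemma joint_section_le m n (J1 : m.-tuple I) (J2 : n.-tuple I)
    (C : set (m.-tuple E * n.-tuple E)) (c : \bar K) :
  mutually_independent P X -> uniq (J1 ++ J2) -> measurable C ->
  (forall t, P [set w | C (t, joint J2 w)] <= c) ->
  P [set w | C (joint J1 w, joint J2 w)] <= c.
Proof.
move=> indX u12 mC.
pose Y1 : {RV P >-> m.-tuple E} := mfun_Sub (mem_set (measurable_joint J1)).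
pose Y2 : {RV P >-> n.-tuple E} := mfun_Sub (mem_set (measurable_joint J2)).
by apply: (indep_section_le (X1 := Y1) (X2 := Y2)) => //; exact: indep_joint.
Qed.

End joint.
End independence.

(** * Linear combinations of independent normal variables *)

Section gaussian.
Context {K : realType}.
Local Notation mu := (@lebesgue_measure K).
Local Open Scope ereal_scope.

Lemma measurable_affine (m c : K) : measurable_fun setT (fun x : K => m + c * x)%R.
Proof. by apply: measurable_funD => //; exact: measurable_funM. Qed.

(** Both sides are measures that agree on the intervals. *)
Lemma lebesgue_measure_affine (m c : K) (A : set K) : (c != 0)%R ->
  measurable A -> mu A = `|c|%:E * mu ((fun x => m + c * x)%R @^-1` A).
Proof.
move=> c0 mA.
pose m' : {measure set (measurableTypeR K) -> \bar K} :=
  mscale (NngNum (normr_ge0 c))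
    (pushforward mu ((fun x => m + c * x)%R : measurableTypeR K -> measurableTypeR K)).
apply: (@lebesgue_measure_unique K (m' (measurable_affine m c))) => // _ [[a b] _ <-].
rewrite -[RHS]/(`|c|%:E * mu ((fun x => m + c * x)%R @^-1` `]a, b]%classic)).
rewrite [LHS]lebesgue_measure_itv/= lte_fin.
have [cpos|cneg] : (0 < c \/ c < 0)%R.
  by move: c0; rewrite neq_lt => /orP[]; [right|left].
- rewrite (_ : _ @^-1` _ = `](a - m) / c, (b - m) / c]%classic)%R; last first.
    apply/seteqP; split=> x /=; rewrite !in_itv /= ltr_pdivrMr// ler_pdivlMr//;
      by rewrite ltrBlDl lerBrDl (mulrC x).
  rewrite lebesgue_measure_itv/= lte_fin ltr_pM2r ?invr_gt0// ltrD2r.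
  case: ifPn => ab; last by rewrite mule0.
  rewrite -!EFinD -EFinM gtr0_norm//; congr EFin; field; lra.
- rewrite (_ : _ @^-1` _ = `[(b - m) / c, (a - m) / c[%classic)%R; last first.
    apply/seteqP; split=> x /=; rewrite !in_itv /= ltr_ndivlMr// ler_ndivrMr//;
      by rewrite ltrBlDl lerBrDl (mulrC x) andbC.
  rewrite lebesgue_measure_itv/= lte_fin ltr_nM2r ?invr_lt0// ltrD2r.
  case: ifPn => ab; last by rewrite mule0.
  by rewrite -!EFinD -EFinM ltr0_norm//; congr EFin; field.
Qed.

Lemma ge0_integral_affine (m c : K) (A : set K) (f : K -> \bar K) : (c != 0)%R ->
  measurable A -> measurable_fun setT f -> (forall x, 0 <= f x) ->
  \int[mu]_(y in A) f y =
    `|c|%:E * \int[mu]_(x in (fun x => m + c * x)%R @^-1` A) f (m + c * x)%R.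
Proof.
move=> c0 mA mf f0.
pose m' : {measure set (measurableTypeR K) -> \bar K} :=
  pushforward mu ((fun x => m + c * x)%R : measurableTypeR K -> measurableTypeR K).
transitivity (\int[mscale (NngNum (normr_ge0 c))
    (m' (measurable_affine m c))]_(y in A) f y).
  apply: eq_measure_integral => B mB _.
  exact: lebesgue_measure_affine.
rewrite ge0_integral_mscale//; last exact: measurable_funTS.
congr (_ * _); rewrite ge0_integral_pushforward//.
  exact: measurable_affine.
exact: measurable_funTS.
Qed.

Lemma normal_pdf_affine (m s x : K) : (s != 0)%R ->
  (`|s| * normal_pdf m s (m + s * x) = normal_pdf 0 1 x)%R.
Proof.
move=> s0; rewrite !normal_pdfE ?oner_eq0// /normal_peak /normal_fun.
rewrite [X in expR X](_ : _ = - (x - 0) ^+ 2 / (1 ^+ 2 *+ 2))%R; last by field.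
rewrite mulrA; congr (_ * _)%R.
rewrite -mulrnAr sqrtrM ?sqr_ge0// sqrtr_sqr invfM mulrA divff ?normr_eq0// mul1r.
by rewrite expr1n mul1r.
Qed.

Lemma normal_prob_affine (m s : K) (A : set K) : (s != 0)%R -> measurable A ->
  normal_prob m s A = normal_prob 0 1 ((fun x => m + s * x)%R @^-1` A).
Proof.
move=> s0 mA; rewrite /normal_prob (@ge0_integral_affine m s)//.
- have mB : measurable ((fun x => m + s * x)%R @^-1` A).
    by rewrite -[X in measurable X]setTI; exact: measurable_affine.
  rewrite -ge0_integralZl//.
  + by apply: eq_integral => x _; rewrite -EFinM normal_pdf_affine.
  + apply: measurable_funTS; apply/measurable_EFinP.
    by apply: measurableT_comp (measurable_affine m s); exact: measurable_normal_pdf.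
  + by move=> x _; rewrite lee_fin normal_pdf_ge0.
- by apply/measurable_EFinP; exact: measurable_normal_pdf.
- by move=> x; rewrite lee_fin normal_pdf_ge0.
Qed.

(** The distribution [normal_prob m s] has a density by definition on sets.  For
    an integrand given by sections, Tonelli reduces the integral to the measure
    of the other sections. *)
Lemma integral_normal_prob_section d (T : measurableType d)
    (m2 : {sigma_finite_measure set T -> \bar K}) (m s : K) (C : set (K * T)) :
  measurable C ->
  \int[normal_prob m s]_z m2 (xsection C z) =
  \int[mu]_z ((normal_pdf m s z)%:E * m2 (xsection C z)).
Proof.
move=> mC.
pose f (p : measurableTypeR K * T) := (normal_pdf m s p.1 * \1_C p)%:E.
have mf : measurable_fun setT f.
  apply/measurable_EFinP; apply: measurable_funM.
    by apply: measurableT_comp (measurable_fst); exact: measurable_normal_pdf.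
  exact: measurable_indic.
have f0 p : 0 <= f p by rewrite lee_fin mulr_ge0// normal_pdf_ge0.
have -> : \int[normal_prob m s]_z m2 (xsection C z) =
    \int[m2]_x normal_prob m s (ysection C x).
  have := @indic_fubini_tonelli _ _ (measurableTypeR K) T K (normal_prob m s) m2 C mC.
  by rewrite indic_fubini_tonelli_FE// indic_fubini_tonelli_GE.
transitivity (\int[m2]_x \int[mu]_z f (z, x)).
  apply: eq_integral => x _; rewrite /normal_prob integral_mkcond.
  apply: eq_integral => z _; rewrite patchE /f /= mem_ysection indicE.
  by case: ifPn; rewrite ?mulr1 ?mulr0.
rewrite -(fubini_tonelli (m1 := mu) f)//; apply: eq_integral => z _.
under eq_integral do rewrite /f EFinM /=.
rewrite ge0_integralZl//.
- congr (_ * _).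
  by have /(congr1 (@^~ z)) := @indic_fubini_tonelli_FE _ _ _ _ K m2 C mC.
- apply/measurable_EFinP.
  by apply: measurableT_comp (measurable_indic mC) (pair1_measurable z).
- by rewrite lee_fin normal_pdf_ge0.
Qed.

(** Completing the square in [z]: the product of the densities of [z] and of
    [u] given [z] is the density of [u] times that of [z] given [u]. *)
Lemma normal_pdf_bayes (s t u z : K) : (s != 0)%R -> (t != 0)%R ->
  let r := Num.sqrt (s ^+ 2 + t ^+ 2) in
  (normal_pdf 0 s z * normal_pdf z t u =
   normal_pdf 0 r u * normal_pdf (u * s ^+ 2 / r ^+ 2) (s * t / r) z)%R.
Proof.
move=> s0 t0 r.
have s2 : (0 < s ^+ 2)%R by rewrite exprn_even_gt0.
have t2 : (0 < t ^+ 2)%R by rewrite exprn_even_gt0.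
have r2 : (0 < s ^+ 2 + t ^+ 2)%R by rewrite addr_gt0.
have rE : (r ^+ 2 = s ^+ 2 + t ^+ 2)%R by rewrite sqr_sqrtr// ltW.
have r0 : (r != 0)%R by rewrite gt_eqF// sqrtr_gt0.
rewrite !normal_pdfE ?mulf_neq0 ?invr_eq0// /normal_peak /normal_fun.
have q0 (a : K) : (0 <= a ^+ 2 * pi *+ 2)%R.
  by rewrite mulrn_wge0// mulr_ge0 ?sqr_ge0 ?pi_ge0.
rewrite mulrACA [RHS]mulrACA -!expRD; congr (_ * expR _)%R.
  rewrite -!invfM -!sqrtrM ?q0//.
  by congr ((Num.sqrt _)^-1)%R; rewrite !(expr_div_n, exprMn) rE; field; rewrite gt_eqF.
rewrite !(expr_div_n, exprMn) rE; field.
by rewrite s0 t0 gt_eqF.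
Qed.

(** The law of the sum of independent centered normal variables of standard
    deviations [s] and [t]: integrate out [z] in [normal_pdf_bayes]. *)
Lemma normal_prob_convolution (s t : K) (A : set K) :
  (s != 0)%R -> (t != 0)%R -> measurable A ->
  \int[normal_prob 0 s]_z normal_prob z t A =
    normal_prob 0 (Num.sqrt (s ^+ 2 + t ^+ 2)) A.
Proof.
move=> s0 t0 mA; set r := Num.sqrt _.
have r2 : (0 < s ^+ 2 + t ^+ 2)%R by rewrite addr_gt0 ?exprn_even_gt0.
have r0 : (r != 0)%R by rewrite gt_eqF// sqrtr_gt0.
pose C := [set p : measurableTypeR K * measurableTypeR K | A (p.1 + t * p.2)%R].
have mC : measurable C.
  rewrite -[X in measurable X]setTI; apply: measurable_funD => //.
  by apply: measurable_funM => //; exact: measurable_snd.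
have CE z : normal_prob z t A = normal_prob 0 1 (xsection C z).
  rewrite normal_prob_affine//; congr (normal_prob _ _ _).
  by apply/seteqP; split=> x /=; rewrite /xsection /= inE.
under eq_integral do rewrite CE.
rewrite (@integral_normal_prob_section _ (measurableTypeR K) (normal_prob 0 1))//.
pose f (p : measurableTypeR K * measurableTypeR K) :=
  (normal_pdf 0 s p.1 * normal_pdf p.1 t p.2 * \1_A p.2)%:E.
have pdfE (z u : K) : normal_pdf z t u = normal_pdf 0 t (u - z).
  by rewrite !normal_pdfE// /normal_fun subr0.
have mpdf : measurable_fun setT (fun p : measurableTypeR K * measurableTypeR K =>
    normal_pdf p.1 t p.2).
  under eq_fun do rewrite pdfE.
  apply: measurableT_comp; first exact: measurable_normal_pdf.
  by apply: measurable_funB; [exact: measurable_snd|exact: measurable_fst].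
have mf : measurable_fun setT f.
  apply/measurable_EFinP; apply: measurable_funM.
    apply: measurable_funM => //.
    by apply: measurableT_comp (measurable_fst); exact: measurable_normal_pdf.
  by apply: measurableT_comp (measurable_snd); exact: measurable_indic.
have f0 p : 0 <= f p by rewrite lee_fin !mulr_ge0// normal_pdf_ge0.
transitivity (\int[mu]_z \int[mu]_u f (z, u)).
  apply: eq_integral => z _.
  transitivity ((normal_pdf 0 s z)%:E * normal_prob z t A); first by rewrite CE.
  have mz : measurable_fun setT (fun u => (normal_pdf z t u)%:E).
    by apply/measurable_EFinP; exact: measurable_normal_pdf.
  rewrite /normal_prob -ge0_integralZl//.
  - rewrite integral_mkcond; apply: eq_integral => u _.
    rewrite patchE /f /= indicE.
    by case: ifPn => uA; rewrite ?mulr1 ?mulr0 ?EFinM.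
  - exact: measurable_funTS.
  - by move=> u _; rewrite lee_fin normal_pdf_ge0.
  - by rewrite lee_fin normal_pdf_ge0.
rewrite (fubini_tonelli f)// /normal_prob [RHS]integral_mkcond.
apply: eq_integral => u _; rewrite patchE.
under eq_integral do rewrite /f /= normal_pdf_bayes//.
rewrite indicE; case: ifPn => uA; last first.
  by rewrite integral0_eq// => z _; rewrite mulr0.
under eq_integral do rewrite mulr1 EFinM.
rewrite ge0_integralZl//.
- by rewrite integral_normal_pdf mule1.
- by apply/measurable_EFinP; exact: measurable_normal_pdf.
- by move=> x _; rewrite lee_fin normal_pdf_ge0.
- by rewrite lee_fin normal_pdf_ge0.
Qed.

Lemma normal_prob_abs (m s : K) : normal_prob m `|s|%R = normal_prob m s.
Proof.
apply/funext => A; apply: eq_integral => x _; congr EFin.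
have [->|s0] := eqVneq s 0%R; first by rewrite normr0.
rewrite !normal_pdfE ?normr_eq0// /normal_peak /normal_fun.
by rewrite -normrX ger0_norm ?sqr_ge0.
Qed.

End gaussian.

Section normal_vectors.
Context d (Omega : measurableType d) {K : realType} (P : probability Omega K).
Local Open Scope ereal_scope.

Lemma indep_normal_sum (X1 X2 : Omega -> K) (s c : K) :
  measurable_fun setT X1 -> measurable_fun setT X2 ->
  (s != 0)%R -> (c != 0)%R ->
  (forall A B, measurable A -> measurable B ->
    P (X1 @^-1` A `&` X2 @^-1` B) = P (X1 @^-1` A) * P (X2 @^-1` B)) ->
  (forall A, measurable A -> P (X1 @^-1` A) = normal_prob 0 s A) ->
  (forall A, measurable A -> P (X2 @^-1` A) = normal_prob 0 1 A) ->
  forall A, measurable A -> P [set w | A (X1 w + c * X2 w)%R] =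
    normal_prob 0 (Num.sqrt (s ^+ 2 + c ^+ 2)) A.
Proof.
move=> mX1 mX2 s0 c0 ind12 law1 law2 A mA.
pose Y1 : {RV P >-> measurableTypeR K} :=
  @mfun_Sub _ _ Omega (measurableTypeR K) X1 (mem_set mX1).
pose Y2 : {RV P >-> measurableTypeR K} :=
  @mfun_Sub _ _ Omega (measurableTypeR K) X2 (mem_set mX2).
pose C := [set p : measurableTypeR K * measurableTypeR K | A (p.1 + c * p.2)%R].
have mC : measurable C.
  rewrite -[X in measurable X]setTI; apply: measurable_funD => //.
  by apply: measurable_funM => //; exact: measurable_snd.
rewrite -[LHS]/(P [set w | C (X1 w, X2 w)]).
rewrite (@indep_law _ _ _ P _ _ _ _ Y1 Y2 ind12)//.
rewrite -normal_prob_convolution//.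
transitivity (\int[distribution P Y1]_z normal_prob z c A); last first.
  by apply: eq_measure_integral => B mB _; exact: law1.
apply: eq_integral => z _; rewrite normal_prob_affine//.
have mz : measurable ((fun x => z + c * x)%R @^-1` A).
  by rewrite -[X in measurable X]setTI; exact: measurable_affine.
rewrite -law2//; congr (P _).
by apply/seteqP; split=> w /=; rewrite /xsection /= inE.
Qed.

Section linear_combination.
Variables (n : nat) (v : {RV P >-> n.-tuple K}) (a : 'I_n -> K).
Hypothesis v_normal : random_normal_vector v.

Lemma measurable_component j : measurable_fun setT (fun w => tnth (v w) j).
Proof. exact: measurableT_comp (measurable_tnth j) _. Qed.

Definition partial_comb (J : seq 'I_n) w := (\sum_(j <- J) a j * tnth (v w) j)%R.

Lemma measurable_partial_comb J : measurable_fun setT (partial_comb J).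
Proof.
apply: measurable_sum => j; apply: measurable_funM => //.
exact: measurable_component.
Qed.

(** By induction on [J], the head of the list being independent of the rest; the
    nonzero weights keep all standard deviations positive. *)
Lemma partial_comb_law j J : uniq (j :: J) ->
  all (fun i => a i != 0%R) (j :: J) ->
  forall A, measurable A -> P (partial_comb (j :: J) @^-1` A) =
    normal_prob 0 (Num.sqrt (\sum_(i <- j :: J) a i ^+ 2)%R) A.
Proof.
have [lawv indv] := v_normal.
elim: J j => [|i J IH] j.
  move=> _ /= /andP[aj _] A mA; rewrite big_seq1 sqrtr_sqr normal_prob_abs.
  have mB : measurable ((fun x => 0 + a j * x)%R @^-1` A).
    by rewrite -[X in measurable X]setTI; exact: measurable_affine.
  rewrite normal_prob_affine// -(lawv j)//; congr (P _).
  by apply/seteqP; split=> w; rewrite /partial_comb /= big_seq1 add0r.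
move=> /= /andP[jJ uJ] /andP[aj aJ] A mA.
pose X1 := partial_comb (i :: J); pose X2 w := tnth (v w) j.
rewrite big_cons addrC -[X in (X + _)%R]sqr_sqrtr; last first.
  by apply: sumr_ge0 => k _; exact: sqr_ge0.
rewrite -(@indep_normal_sum X1 X2 _ _ (measurable_partial_comb (i :: J))
  (measurable_component j))//.
- have e w : partial_comb [:: j, i & J] w = (X1 w + a j * X2 w)%R.
    by rewrite /X1 /partial_comb big_cons addrC.
  by congr (P _); apply/seteqP; split=> w /=; rewrite e.
- rewrite gt_eqF// sqrtr_gt0 big_cons ltr_pwDl ?exprn_even_gt0//.
    by case/andP: aJ => ->.
  by apply: sumr_ge0 => k _; exact: sqr_ge0.
- move=> B1 B2 mB1 mB2.
  have u : uniq (in_tuple (i :: J) ++ [tuple j]).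
    by rewrite -[X in uniq X]/((i :: J) ++ [:: j]) cats1 rcons_uniq jJ.
  have := indep_joint measurable_component indv u.
  pose f1 (t : (size (i :: J)).-tuple K) :=
    (\sum_k a (tnth (in_tuple (i :: J)) k) * tnth t k)%R.
  have mf1 : measurable_fun setT f1.
    apply: measurable_sum => k; apply: measurable_funM => //.
    exact: measurable_tnth.
  have mf2 := @measurable_tnth _ K 1 ord0.
  move=> /(_ (f1 @^-1` B1) ((fun t => tnth t ord0) @^-1` B2)) indep.
  have E1 : X1 @^-1` B1 = joint (fun k w => tnth (v w) k)
      (in_tuple (i :: J)) @^-1` (f1 @^-1` B1).
    have e w : X1 w = f1 (joint (fun k w => tnth (v w) k) (in_tuple (i :: J)) w).
      rewrite /X1 /f1 /partial_comb big_tnth; apply: eq_bigr => k _.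
      by rewrite tnth_mktuple.
    by apply/seteqP; split=> w /=; rewrite e.
  have E2 : X2 @^-1` B2 = joint (fun k w => tnth (v w) k)
      [tuple j] @^-1` ((fun t => tnth t ord0) @^-1` B2).
    by apply/seteqP; split=> w /=; rewrite tnth_mktuple.
  by rewrite E1 E2 indep// -[X in measurable X]setTI; [exact: mf1|exact: mf2].
- exact: IH.
- by move=> B mB; rewrite -(lawv j).
Qed.

(** A sum of independent centered normal variables is centered normal and the
    variances add up; the terms with weight zero drop out. *)
Lemma normal_linear_combination : (exists j, a j != 0%R) ->
  forall A, measurable A ->
  P [set w | A (\sum_j a j * tnth (v w) j)%R] =
    normal_prob 0 (Num.sqrt (\sum_j a j ^+ 2)%R) A.
Proof.
move=> [j aj] A mA; pose J := [seq k <- enum 'I_n | a k != 0%R].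
have jJ : j \in J by rewrite mem_filter aj mem_enum.
have uJ : uniq J by rewrite filter_uniq// enum_uniq.
have aJ : all (fun i => a i != 0%R) J by exact: filter_all.
have sumJ (F : 'I_n -> K) : (forall k, a k = 0 -> F k = 0)%R ->
    (\sum_k F k = \sum_(k <- J) F k)%R.
  move=> F0; rewrite big_filter big_enum_cond /= (bigID (fun k => a k != 0%R)) /=.
  rewrite [X in (_ + X)%R]big1 ?addr0// => k; rewrite negbK => /eqP.
  exact: F0.
rewrite sumJ; last by move=> k ->; rewrite expr0n.
have -> : [set w | A (\sum_j a j * tnth (v w) j)%R] = partial_comb J @^-1` A.
  apply/seteqP; split=> w; rewrite /partial_comb /= sumJ// => k ->;
    by rewrite mul0r.
case: J jJ uJ aJ {sumJ} => // i J _ uJ aJ.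
exact: partial_comb_law.
Qed.

End linear_combination.
End normal_vectors.

(** * The error function *)

Section error_function_theory.
Context {K : realType}.
Local Notation mu := (@lebesgue_measure K).

Lemma integral_gauss_fin (A : set K) : measurable A ->
  (\int[mu]_(x in A) (gauss_fun x)%:E)%E \is a fin_num.
Proof.
move=> mA; apply: integrable_fin_num => //.
exact: integrableS (integrableT_gauss).
Qed.

Lemma erfE (q : K) : 0 <= q ->
  (erf q)%:E = ((2 / Num.sqrt pi)%:E *
    \int[mu]_(x in `[0%R, q]) (gauss_fun x)%:E)%E.
Proof.
move=> q0; rewrite /erf q0 EFinM; congr (_ * _)%E.
by rewrite fineK// integral_gauss_fin.
Qed.

Lemma integral_gauss_sym (q : K) : 0 <= q ->
  (\int[mu]_(x in `[(- q)%R, q]) (gauss_fun x)%:E =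
   2%:E * \int[mu]_(x in `[0%R, q]) (gauss_fun x)%:E)%E.
Proof.
move=> q0.
have mg : measurable_fun setT (EFin \o @gauss_fun K).
  by apply/measurable_EFinP; exact: measurable_gauss_fun.
have g0 (x : K) : (0 <= (gauss_fun x)%:E)%E by rewrite lee_fin gauss_fun_ge0.
have -> : `[- q, q]%classic = `[- q, 0[%classic `|` `[0, q]%classic.
  apply/seteqP; split=> x; rewrite /= !in_itv /=.
    by have [x0|x0] := ltP x 0 => /andP[? ?]; [left|right]; rewrite ?andbT.
  by case=> /andP[? ?]; lra.
rewrite ge0_integral_setU//=.
- rewrite (_ : 2%:E = 1%:E + 1%:E)%E; last by rewrite -EFinD.
  rewrite ge0_muleDl// !mul1e; congr (_ + _)%E.
  rewrite (@ge0_integral_affine K 0 (-1))//.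
    rewrite normrN1 mul1e.
    have -> : (fun x => 0 + -1 * x) @^-1` `[- q, 0[ = `]0, q]%classic.
      by apply/seteqP; split=> x /=; rewrite !in_itv /=; lra.
    rewrite integral_itv_obnd_cbnd; last first.
      apply/measurable_funTS/(measurableT_comp mg).
      exact: measurable_affine.
    apply: eq_integral => x _; congr EFin.
    by rewrite add0r mulN1r /gauss_fun sqrrN.
- exact: measurable_funTS.
- apply/disj_setPS => x /= []; rewrite !in_itv /=; lra.
Qed.

(** The substitution [x = s sqrt 2 t] turns the density into
    [exp (- t ^ 2) / sqrt pi]. *)
Lemma normal_prob_erf (s q : K) : 0 < s -> 0 <= q ->
  normal_prob 0 s `[- (s * Num.sqrt 2 * q), s * Num.sqrt 2 * q] = (erf q)%:E.
Proof.
move=> s0 q0.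
have g0 (x : K) : (0 <= (gauss_fun x)%:E)%E by rewrite lee_fin gauss_fun_ge0.
have n0 (x : K) : (0 <= (normal_pdf 0 s x)%:E)%E by rewrite lee_fin normal_pdf_ge0.
have r2 : 0 < Num.sqrt 2 :> K by rewrite sqrtr_gt0.
have c0 : 0 < s * Num.sqrt 2 by rewrite mulr_gt0.
rewrite /normal_prob (@ge0_integral_affine K 0 (s * Num.sqrt 2)) ?gt_eqF//.
- have -> : (fun x => 0 + s * Num.sqrt 2 * x) @^-1`
      `[- (s * Num.sqrt 2 * q), s * Num.sqrt 2 * q] = `[- q, q]%classic.
    apply/seteqP; split=> x /=; rewrite !in_itv /= add0r -mulrN;
      by rewrite !ler_pM2l.
  rewrite erfE// EFinM [(2%:E * _)%E]muleC -muleA -integral_gauss_sym//.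
  rewrite -!ge0_integralZl//.
  + apply: eq_integral => x _; rewrite -!EFinM; congr EFin.
    rewrite normal_pdfE ?gt_eqF// /normal_peak /normal_fun /gauss_fun gtr0_norm//.
    rewrite mulrA; congr (_ * expR _); last first.
      rewrite add0r subr0 !exprMn sqr_sqrtr//; field.
      by rewrite gt_eqF.
    rewrite -mulrnAr sqrtrM ?sqr_ge0// sqrtr_sqr gtr0_norm// -(mulr_natl pi 2).
    rewrite (sqrtrM pi)//; field.
    by rewrite !gt_eqF ?sqrtr_gt0 ?pi_gt0.
  + by apply/measurable_EFinP/measurable_funTS; exact: measurable_gauss_fun.
  + apply/measurable_EFinP/measurable_funTS.
    by apply: measurableT_comp (measurable_affine _ _); exact: measurable_normal_pdf.
- by apply/measurable_EFinP; exact: measurable_normal_pdf.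
Qed.

Lemma erf_le0 (x : K) : x <= 0 -> erf x <= 0.
Proof.
move=> x0; have c0 : 0 <= 2 / Num.sqrt pi :> K by rewrite divr_ge0// sqrtr_ge0.
rewrite /erf; case: ifPn => [x0'|_].
  have -> : x = 0 by apply/eqP; rewrite eq_le x0.
  by rewrite set_itv1 Rintegral_set1 mulr0.
rewrite mulrN oppr_le0 mulr_ge0//; apply: Rintegral_ge0 => t _.
exact: expR_ge0.
Qed.

(** On the nonnegative reals [erf] is continuous and, by the Gaussian integral,
    tends to [1], so that the intermediate value theorem applies. *)
Lemma erf_surj (p : K) : 0 < p < 1 -> exists q, erf q = p.
Proof.
move=> /andP[p0 p1].
pose G (x : K) := \int[mu]_(t in `[0, x]) gauss_fun t.
have s0 : 0 < Num.sqrt pi :> K by rewrite sqrtr_gt0 pi_gt0.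
have GE x : 0 <= x -> erf x = 2 / Num.sqrt pi * G x by move=> x0; rewrite /erf x0.
have lim : (\int[mu]_(x in `[0%R, n%:R]) (gauss_fun x)%:E)%E @[n --> \oo] -->
    (Num.sqrt pi / 2 : K)%:E.
  rewrite -integral0y_gauss.
  exact: (@ge0_cvgn_integral K mu _ gauss_fun_ge0 measurable_gauss_fun).
have [n hn] : exists n : nat, p < erf (n%:R : K).
  apply: contrapT => /forallNP h.
  have := lime_le (cvgP _ lim) (nearW _ (fun n => _)) (x := (p * (Num.sqrt pi / 2))%:E).
  rewrite (cvg_lim _ lim)// lee_fin ler_pMl ?divr_gt0// leNgt p1.
  suff /[swap]/[apply] : forall n : nat, (\int[mu]_(x in `[0%R, n%:R]) (gauss_fun x)%:E
     <= (p * (Num.sqrt pi / 2))%:E)%E by [].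
  move=> n; have /negP := h n; rewrite -leNgt GE// => hn.
  rewrite -[leLHS]fineK ?integral_gauss_fin// lee_fin -[fine _]/(G n%:R).
  have -> : G n%:R = (2 / Num.sqrt pi * G n%:R) * (Num.sqrt pi / 2).
    by field; rewrite gt_eqF.
  by rewrite ler_wpM2r// divr_ge0// ltW.
have cG : {within `[(0 : K), n%:R], continuous G}.
  apply: parameterized_integral_continuous => //.
  exact: integrableS (integrableT_gauss).
have [] := @IVT _ G 0 n%:R (p * (Num.sqrt pi / 2)) _ cG => //.
  have G0 : G 0 = 0 by rewrite /G set_itv1 Rintegral_set1.
  move: hn; rewrite GE// -(ltr_pM2r (_ : 0 < Num.sqrt pi / 2))// ?divr_gt0// => hn.
  have {}hn : p * (Num.sqrt pi / 2) < G n%:R.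
    by apply: lt_le_trans hn _; rewrite le_eqVlt; apply/orP; left; apply/eqP;
      field; rewrite gt_eqF.
  have pc : 0 < p * (Num.sqrt pi / 2) by rewrite mulr_gt0// divr_gt0.
  have le : p * (Num.sqrt pi / 2) <= G n%:R by lra.
  by rewrite G0 ge_min le_max (ltW pc) le orbT.
move=> q; rewrite in_itv /= => /andP[q0 _] Gq; exists q.
by rewrite GE// Gq; field; rewrite gt_eqF.
Qed.

Lemma erf_invK (p : K) : 0 < p < 1 -> erf (erf_inv p) = p.
Proof.
move=> /erf_surj[q qp]; rewrite /erf_inv; case: xgetP => [x _ //|/(_ q)].
by rewrite /= qp.
Qed.

Lemma erf_inv_gt0 (p : K) : 0 < p < 1 -> 0 < erf_inv p.
Proof.
move=> p01; rewrite ltNge; apply/negP => /erf_le0; rewrite erf_invK//.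
by case/andP: p01; lra.
Qed.

End error_function_theory.

(** * Measurability of residuals *)

Section random_vectors_of_the_space.
Context {K : realType} d (X : measurableType d).
Implicit Types V : vectType K.

(** Measurability for the Borel structure of a finite-dimensional space,
    expressed by coordinates in a fixed basis. *)
Definition vmeasurable V (f : X -> V) :=
  forall i, measurable_fun setT (fun x => coord (vbasis {:V}) i (f x)).

Lemma vmeasurable_dot V (dV : {dot V for idfun}) (f g : X -> V) :
  vmeasurable f -> vmeasurable g -> measurable_fun setT (fun x => dV (f x) (g x)).
Proof.
move=> mf mg; pose e := vbasis {:V}.
have -> : (fun x => dV (f x) (g x)) = (fun x => \sum_i \sum_j
    coord e i (f x) * coord e j (g x) * dV e`_i e`_j).
  apply/funext => x; rewrite {1}(coord_vbasis (memvf (f x))) dot_suml.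
  apply: eq_bigr => i _; rewrite {1}(coord_vbasis (memvf (g x))) dot_sumr.
  by apply: eq_bigr => j _; rewrite dotZl dotZr mulrA.
apply: measurable_sum => i; apply: measurable_sum => j.
by apply: measurable_funM => //; apply: measurable_funM; [exact: mf|exact: mg].
Qed.

Lemma vmeasurableD V (f g : X -> V) : vmeasurable f -> vmeasurable g ->
  vmeasurable (fun x => f x + g x).
Proof.
move=> mf mg i; under eq_fun do rewrite linearD /=.
by apply: measurable_funD; [exact: mf|exact: mg].
Qed.

Lemma vmeasurableZ V (a : X -> K) (f : X -> V) : measurable_fun setT a ->
  vmeasurable f -> vmeasurable (fun x => a x *: f x).
Proof.
move=> ma mf i; under eq_fun do rewrite linearZ /=.
by apply: measurable_funM => //; exact: mf.
Qed.

Lemma vmeasurable_cst V (v : V) : vmeasurable (fun=> v).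
Proof. by move=> i; exact: measurable_cst. Qed.

Lemma vmeasurable_sum V n (F : 'I_n -> X -> V) : (forall j, vmeasurable (F j)) ->
  vmeasurable (fun x => \sum_j F j x).
Proof.
move=> mF i; under eq_fun do rewrite linear_sum /=.
by apply: measurable_sum => j; exact: mF.
Qed.

Lemma measurable_hnorm V (dV : {dot V for idfun}) (f : X -> V) :
  vmeasurable f -> measurable_fun setT (fun x => hnorm dV (f x)).
Proof.
move=> mf; have msqrt : measurable_fun setT (@Num.sqrt K).
  exact: continuous_measurable_fun (@sqrt_continuous K).
exact: measurableT_comp msqrt (vmeasurable_dot dV mf mf).
Qed.

Lemma measurable_le_set (f g : X -> K) : measurable_fun setT f ->
  measurable_fun setT g -> measurable [set x | f x <= g x].
Proof.
move=> mf mg; rewrite -[X in measurable X]setTI.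
exact: measurable_fun_le.
Qed.

Lemma measurable_lt_set (f g : X -> K) : measurable_fun setT f ->
  measurable_fun setT g -> measurable [set x | f x < g x].
Proof.
move=> mf mg; rewrite (_ : [set x | f x < g x] = ~` [set x | g x <= f x]).
  exact/measurableC/measurable_le_set.
by apply/seteqP; split=> x /=; rewrite ltNge => /negP.
Qed.

Lemma measurable_eq0 V (dV : {dot V for idfun}) (f : X -> V) :
  vmeasurable f -> measurable [set x | f x = 0].
Proof.
move=> mf; rewrite (_ : [set x | f x = 0] = [set x | dV (f x) (f x) <= 0]).
  by apply: measurable_le_set => //; exact: vmeasurable_dot.
apply/seteqP; split=> x /= h; first by rewrite h dot0r.
by apply/eqP; rewrite -(dot_eq0 dV) eq_le h dot_ge0.
Qed.

End random_vectors_of_the_space.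

Section one_run.
Context {K : realType} (S R : vectType K).
Variables (dS : {dot S for idfun}) (dR : {dot R for idfun}).
Variables (b : (\dim {:S}).-tuple S) (b_basis : basis_of {:S} b).
Variables (T : 'Hom(S, R)).
Notation E := ((\dim {:S}).-tuple K).
Implicit Types (s : nat -> E) (W : {vspace R}).

Lemma of_coordsE (y : E) : of_coords b y = passmx.vecof b (\row_i tnth y i).
Proof. by []. Qed.

Lemma lfun_of_coords (V : vectType K) (O : 'Hom(S, V)) (y : E) :
  O (of_coords b y) = \sum_i tnth y i *: O b`_i.
Proof.
by rewrite of_coordsE lfun_vecof; apply: eq_bigr => i _; rewrite mxE.
Qed.

Lemma residualE W x : residual dR T W x = orth_rest dR W (T x).
Proof. by rewrite /residual add_lfunE opp_lfunE comp_lfunE. Qed.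

Lemma range_space0 s : range_space b T s 0 = 0%VS.
Proof. by rewrite /range_space /= span_nil. Qed.

Lemma range_spaceS s n : range_space b T s n.+1 =
  << rcons [seq T (of_coords b (s k)) | k <- iota 0 n] (T (of_coords b (s n))) >>%VS.
Proof. by rewrite /range_space -addn1 iotaD map_cat cats1. Qed.

Lemma eq_range_space s s' n : (forall k, (k < n)%N -> s k = s' k) ->
  range_space b T s n = range_space b T s' n.
Proof.
move=> h; congr (span _); apply/eq_in_map => k.
by rewrite mem_iota add0n => /h ->.
Qed.

Lemma range_space_sub s n : (range_space b T s n <= limg T)%VS.
Proof.
apply/span_subvP => _ /mapP[k _ ->]; exact: memv_img (memvf _).
Qed.

(** An incomplete space is detected by a basis vector with nonzero residual,
    which keeps the condition a finite one. *)
Lemma residual_basis_eq0 W : (W <= limg T)%VS ->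
  (forall j : 'I_(\dim {:S}), residual dR T W b`_j = 0) -> W = limg T.
Proof.
move=> WT h; apply/eqP; rewrite eqEsubv WT; apply/subvP => _ /memv_imgP[x _ ->].
rewrite -(orth_rest_eq0 dR) -residualE.
have [y ->] := vecof_surj b_basis x; rewrite lfun_vecof big1// => j _.
by rewrite h scaler0.
Qed.

Lemma residual_limg : residual dR T (limg T) = 0.
Proof.
apply/lfunP => x; rewrite residualE zero_lfunE; apply/eqP.
by rewrite orth_rest_eq0 memv_img ?memvf.
Qed.

Lemma dim_range_spaceS s n : T (of_coords b (s n)) \notin range_space b T s n ->
  \dim (range_space b T s n.+1) = (\dim (range_space b T s n)).+1.
Proof.
move=> h; rewrite range_spaceS -cats1 span_cat span_seq1 -/(range_space b T s n).
rewrite dimv_disjoint_sum; last first.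
  apply/eqP; rewrite -subv0; apply/subvP => w; rewrite memv_cap memv0.
  move=> /andP[wW /vlineP[k wE]]; rewrite wE.
  have [->|k0] := eqVneq k 0; first by rewrite scale0r.
  case/negP: h; rewrite -(scale1r (T _)) -(mulVf k0) -scalerA -wE.
  exact: rpredZ.
rewrite dim_vline.
have -> : T (of_coords b (s n)) != 0.
  by apply: contraNneq h => ->; rewrite mem0v.
by rewrite addn1.
Qed.

Section measurability.
Context d (X : measurableType d) (s : nat -> X -> E).
Hypothesis ms : forall k, measurable_fun setT (s k).

Lemma vmeasurable_of_coords (V : vectType K) (O : 'Hom(S, V)) (y : X -> E) :
  measurable_fun setT y -> vmeasurable (fun x => O (of_coords b (y x))).
Proof.
move=> my; under eq_fun do rewrite lfun_of_coords.
apply: (vmeasurable_sum (F := fun i x => tnth (y x) i *: O b`_i)) => i.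
apply: vmeasurableZ; last exact: vmeasurable_cst.
exact: measurableT_comp (measurable_tnth i) my.
Qed.

(** The space itself is random here; [orth_rest_rcons] expresses its orthogonal
    component by those for fewer vectors. *)
Lemma vmeasurable_orth_rest n (f : X -> R) : vmeasurable f ->
  vmeasurable (fun x => orth_rest dR (range_space b T (s^~ x) n) (f x)).
Proof.
elim: n f => [|n IH] f mf.
  by under eq_fun do rewrite /range_space /= orth_rest_nil.
under eq_fun do rewrite range_spaceS orth_rest_rcons -scaleNr -/(range_space b T _ n).
have mf' := IH _ mf.
have ms' := IH _ (vmeasurable_of_coords T (ms n)).
apply: vmeasurableD => //; apply: vmeasurableZ => //.
apply: measurable_funN; apply: measurable_funM; first exact: vmeasurable_dot.
(* Inversion on nonnegative reals is the power of exponent [-1]. *)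
under eq_fun do rewrite -powR_inv1 ?dot_ge0//.
exact: measurableT_comp (measurable_powR _) (vmeasurable_dot dR ms' ms').
Qed.

Lemma vmeasurable_residual n (y : X -> S) : vmeasurable (fun x => T (y x)) ->
  vmeasurable (fun x => residual dR T (range_space b T (s^~ x) n) (y x)).
Proof.
move=> my; under eq_fun do rewrite residualE.
exact: vmeasurable_orth_rest.
Qed.

Lemma measurable_opnorm_gt (S_gt0 : (0 < \dim {:S})%N) n tol : 0 <= tol ->
  measurable [set x | tol < opnorm dS dR (residual dR T (range_space b T (s^~ x) n))].
Proof.
move=> tol0.
pose v (q : 'rV[rat]_(\dim {:S})) := passmx.vecof b (map_mx (ratr : rat -> K) q).
rewrite (_ : [set x | _] = \bigcup_q [set x | tol * hnorm dS (v q) <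
    hnorm dR (residual dR T (range_space b T (s^~ x) n) (v q))]); last first.
  apply/seteqP; split=> x /=.
    by move=> /(opnorm_gtP _ _ b_basis S_gt0 _ tol0)[q h]; exists q.
  by move=> [q _ h]; apply/(opnorm_gtP _ _ b_basis S_gt0 _ tol0); exists q.
apply: countable_bigcupT_measurable => [//|q]; apply: measurable_lt_set => //.
by apply/measurable_hnorm/vmeasurable_residual/vmeasurable_cst.
Qed.

End measurability.
End one_run.

(** * Probability bounds for a fixed operator *)

Section bounds.
Context {K : realType} (S R : vectType K).
Variables (dS : {dot S for idfun}) (dR : {dot R for idfun}).
Variables (b : (\dim {:S}).-tuple S) (b_basis : basis_of {:S} b).
Hypothesis S_gt0 : (0 < \dim {:S})%N.
Context d (Omega : measurableType d) (P : probability Omega K).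
Notation E := ((\dim {:S}).-tuple K).
Notation lmin := (lambda_min (gram dS b)).
Implicit Types v : {RV P >-> E}.

Lemma scalar_form_law v (O : 'Hom(S, R)) (u : R) : random_normal_vector v ->
  (exists j : 'I_(\dim {:S}), dR u (O b`_j) != 0) ->
  forall A, measurable A -> P [set w | A (dR u (O (of_coords b (v w))))] =
    normal_prob 0 (Num.sqrt (\sum_(j < \dim {:S}) dR u (O b`_j) ^+ 2)) A.
Proof.
move=> nv u0 A mA; rewrite -(normal_linear_combination nv u0 mA).
congr (P _); apply/funext => w /=; rewrite lfun_of_coords dot_sumr; congr (A _).
by apply: eq_bigr => j _; rewrite dotZr mulrC.
Qed.

(** The event is contained in [<u, O D^-1 v> = 0] for [u] a nonzero value of [O]
    on the basis, and [<u, O D^-1 v>] has a density. *)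
Lemma normal_vector_ker_null v (O : 'Hom(S, R)) : random_normal_vector v ->
  (exists j : 'I_(\dim {:S}), O b`_j != 0) ->
  P [set w | O (of_coords b (v w)) = 0] = 0%E.
Proof.
move=> nv [j Oj]; pose u := O b`_j.
have u0 : exists j : 'I_(\dim {:S}), dR u (O b`_j) != 0.
  by exists j; rewrite dot_eq0.
have mO : measurable_fun setT v by [].
have mA : measurable [set w | O (of_coords b (v w)) = 0].
  by apply: (measurable_eq0 dR); exact: vmeasurable_of_coords.
have m0 : measurable [set w | [set (0 : K)] (dR u (O (of_coords b (v w))))].
  rewrite -[X in measurable X]setTI.
  have : measurable_fun setT (fun w => dR u (O (of_coords b (v w)))).
    apply: vmeasurable_dot; first exact: vmeasurable_cst.
    exact: vmeasurable_of_coords.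
  by apply.
apply/eqP; rewrite -measure_le0.
apply: (@le_trans _ _ (P [set w | [set (0 : K)] (dR u (O (of_coords b (v w))))])).
  by apply: le_measure; rewrite ?inE// => w /= ->; rewrite dot0r.
rewrite (scalar_form_law nv u0)//.
by rewrite /normal_prob integral_set1.
Qed.

(** Choose [z] with [|O z| > tol |z|], of coordinates [y], and [u] the unit
    vector along [O z].  The norm is at least [|<u, O D^-1 v>|], which is the
    absolute value of a centered normal variable of variance [A], the sum of
    the [<u, O b_j> ^ 2].  Now [|O z| ^ 2 = <u, O z> ^ 2 <= A |y| ^ 2] and
    [lambda_min |y| ^ 2 <= |z| ^ 2] give [A > tol ^ 2 lambda_min]. *)
Lemma single_test_bound v (O : 'Hom(S, R)) (tol q : K) : random_normal_vector v ->
  0 < tol -> 0 <= q -> tol < opnorm dS dR O ->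
  (P [set w | (hnorm dR (O (of_coords b (v w))) <=
      tol * (Num.sqrt (2 * lmin) * q))%R]
    <= (erf q)%:E)%E.
Proof.
move=> nv tol0 q0 /(opnorm_gtP _ _ b_basis S_gt0 _ (ltW tol0))[x].
set y := map_mx _ _; set z := passmx.vecof b y => Oz.
have l0 : 0 < lmin by exact: lambda_min_gram_gt0.
have Oz0 : 0 < hnorm dR (O z).
  by apply: le_lt_trans Oz; rewrite mulr_ge0 ?hnorm_ge0// ltW.
pose u := (hnorm dR (O z))^-1 *: O z.
have uu : hnorm dR u = 1.
  apply/eqP; rewrite -(@eqrXn2 _ 2)// ?hnorm_ge0// sqr_hnorm dotZl dotZr -sqr_hnorm.
  by rewrite expr1n; apply/eqP; field; rewrite gt_eqF.
have uz : dR u (O z) = hnorm dR (O z).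
  by rewrite dotZl -sqr_hnorm; field; rewrite gt_eqF.
pose a (j : 'I_(\dim {:S})) := dR u (O b`_j).
have uzE : dR u (O z) = \sum_j a j * y 0 j.
  by rewrite /z lfun_vecof dot_sumr; apply: eq_bigr => j _; rewrite dotZr mulrC.
pose A := \sum_j a j ^+ 2; pose Y := \sum_j y 0 j ^+ 2.
have Alarge : tol ^+ 2 * lmin < A.
  have Y0 : 0 <= Y by apply: sumr_ge0 => j _; exact: sqr_ge0.
  have cs : hnorm dR (O z) ^+ 2 <= A * Y.
    by rewrite -uz uzE; exact: sum_cauchy_schwarz.
  have ray : lmin * Y <= hnorm dS z ^+ 2.
    by rewrite sqr_hnorm /Y -qform1; exact: gram_rayleigh.
  have Oz2 : tol ^+ 2 * hnorm dS z ^+ 2 < hnorm dR (O z) ^+ 2.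
    by rewrite -exprMn ltr_pXn2r// ?nnegrE ?hnorm_ge0// mulr_ge0 ?hnorm_ge0// ltW.
  have lt : tol ^+ 2 * lmin * Y < A * Y.
    apply: lt_le_trans cs; apply: le_lt_trans Oz2.
    by rewrite -mulrA ler_wpM2l// sqr_ge0.
  rewrite ltNge; apply/negP => /(ler_wpM2r Y0) le.
  by have := lt_le_trans lt le; rewrite ltxx.
have u0 : exists j : 'I_(\dim {:S}), dR u (O b`_j) != 0.
  apply: contrapT => /forallNP h.
  have : A = 0.
    apply: big1 => j _; have /negP := h j; rewrite negbK /a => /eqP ->.
    by rewrite expr0n.
  move=> A0; move: Alarge; rewrite A0 ltNge mulr_ge0 ?sqr_ge0//; exact: ltW.
have sA : tol * Num.sqrt lmin <= Num.sqrt A.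
  rewrite -(ger0_norm (ltW tol0)) -sqrtr_sqr -sqrtrM ?sqr_ge0//.
  by rewrite ler_wsqrtr// ltW.
have sA0 : 0 < Num.sqrt A.
  by apply: lt_le_trans sA; rewrite mulr_gt0// sqrtr_gt0.
rewrite -(normal_prob_erf sA0 q0) -(scalar_form_law nv u0)//.
have mO : measurable_fun setT v by [].
apply: le_measure; rewrite ?inE.
- apply: measurable_le_set => //.
  by apply: measurable_hnorm; exact: vmeasurable_of_coords.
- rewrite -[X in measurable X]setTI.
  have : measurable_fun setT (fun w => dR u (O (of_coords b (v w)))).
    apply: vmeasurable_dot; first exact: vmeasurable_cst.
    exact: vmeasurable_of_coords.
  by apply.
- move=> w /= h; rewrite in_itv /= -ler_norml.
  apply: le_trans (dot_cauchy_schwarz _ _ _) _; rewrite uu mul1r.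
  apply: le_trans h _; rewrite mulrA ler_wpM2r// sqrtrM// mulrCA mulrC.
  by rewrite ler_wpM2r ?sqrtr_ge0.
Qed.

End bounds.

(** * One run of the algorithm *)

Section failure.
Context {K : realType} (S R : vectType K).
Variables (dS : {dot S for idfun}) (dR : {dot R for idfun}).
Variables (b : (\dim {:S}).-tuple S) (b_basis : basis_of {:S} b).
Variables (T : 'Hom(S, R)).
Hypothesis T_rank : (0 < \dim (limg T))%N.
Variables (tol : K) (n_t : nat).
Hypothesis tol_gt0 : 0 < tol.
Hypothesis n_t_gt0 : (0 < n_t)%N.
Variable eps : K.
Hypothesis eps01 : 0 < eps < 1.
Context d (Omega : measurableType d) (P : probability Omega K).
Notation E := ((\dim {:S}).-tuple K).
Variables (r : 'I_n_t -> {RV P >-> E}) (s : nat -> {RV P >-> E}).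
Hypothesis r_normal : forall i, random_normal_vector (r i).
Hypothesis s_normal : forall k, random_normal_vector (s k).

Definition draws (k : 'I_n_t + nat) : Omega -> E :=
  match k return Omega -> E with inl i => r i | inr j => s j end.

Hypothesis draws_indep : mutually_independent P draws.

Let S_gt0 : (0 < \dim {:S})%N.
Proof.
by apply: leq_trans T_rank _; rewrite -(limg_ker_dim T {:S}) leq_addl.
Qed.

Lemma measurable_draws k : measurable_fun setT (draws k).
Proof. by case: k. Qed.

Notation c := (c_est dS b n_t eps).
(** The bound for the probability that a single test is passed wrongly. *)
Let pass_prob := eps `^ (n_t%:R)^-1.

Lemma pass_prob01 : 0 < pass_prob < 1.
Proof.
have /andP[e0 e1] := eps01.
have : pass_prob < 1 `^ (n_t%:R^-1).
  by rewrite gt0_ltr_powR ?invr_gt0 ?ltr0n// ?nnegrE// ltW.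
by rewrite powR1 powR_gt0// => ->.
Qed.

Lemma pass_prob_exp : pass_prob ^+ n_t = eps.
Proof.
have /andP[e0 e1] := eps01.
rewrite /pass_prob -powR_mulrn ?powR_ge0// -powRrM mulVf ?powRr1//; first exact: ltW.
by rewrite pnatr_eq0 -lt0n.
Qed.

Lemma c_est_gt0 : 0 < c.
Proof.
rewrite invr_gt0 mulr_gt0//; last exact: erf_inv_gt0 pass_prob01.
by rewrite sqrtr_gt0 mulr_gt0// lambda_min_gram_gt0.
Qed.

Lemma c_est_le h : (c * h <= tol) =
  (h <= tol * (Num.sqrt (2 * lambda_min (gram dS b)) * erf_inv pass_prob)).
Proof.
have c0 := c_est_gt0.
by rewrite /c_est mulrC ler_pdivrMr// -invr_gt0.
Qed.

Lemma prode_le (I : eqType) (J : seq I) (f : I -> \bar K) (a : K) :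
  (forall i, 0 <= f i)%E -> (forall i, f i <= a%:E)%E ->
  (\prod_(i <- J) f i <= (a ^+ size J)%:E)%E.
Proof.
move=> f0 fa; elim: J => [|i J IH]; first by rewrite big_nil expr0.
by rewrite big_cons /= exprS EFinM lee_pmul// prode_ge0.
Qed.

(** The tests are independent, and each is passed with probability at most
    [pass_prob]. *)
Lemma all_tests_bound (W : {vspace R}) : tol < opnorm dS dR (residual dR T W) ->
  (P [set w | forall i,
     (c * hnorm dR (residual dR T W (of_coords b (r i w))) <= tol)%R] <= eps%:E)%E.
Proof.
move=> Wtol.
pose A := [set y : E | c * hnorm dR (residual dR T W (of_coords b y)) <= tol].
have mA : measurable A.
  apply: measurable_le_set => //; apply: measurable_funM => //.
  by apply: measurable_hnorm; exact: vmeasurable_of_coords.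
pose J : seq ('I_n_t + nat) := [seq inl i | i <- enum 'I_n_t].
have uJ : uniq J by rewrite map_inj_uniq ?enum_uniq// => i j [].
rewrite (_ : [set w | _] = \bigcap_(k in [set` J]) (draws k @^-1` A)); last first.
  apply/seteqP; split=> w /=.
    by move=> h k /= /mapP[i _ ->]; exact: h.
  by move=> h i; apply: (h (inl i)); rewrite /= map_f// mem_enum.
rewrite (draws_indep uJ)//.
rewrite -pass_prob_exp -[n_t in X in (_ <= X)%E]card_ord cardE.
have -> : (\prod_(k <- J) P (draws k @^-1` A) =
    \prod_(i <- enum 'I_n_t) P (r i @^-1` A))%E by rewrite big_map.
apply: prode_le => i; first exact: measure_ge0.
have /andP[p0 p1] := pass_prob01.
rewrite -(erf_invK pass_prob01); apply: le_trans (single_test_bound b_basis S_gt0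
  (r_normal i) tol_gt0 (ltW (erf_inv_gt0 pass_prob01)) Wtol).
by under eq_set do rewrite -c_est_le.
Qed.

Notation W_ n w := (range_space b T (s^~ w) n).

(** At stage [n] the new draw does not enlarge a space that is not yet the range
    of [T]. *)
Definition stalls n := [set w | T (of_coords b (s n w)) \in W_ n w /\
  exists j : 'I_(\dim {:S}), residual dR T (W_ n w) b`_j != 0].

(** At stage [n] all tests are passed although the tolerance is exceeded. *)
Definition accepts_bad n := [set w |
  (tol < opnorm dS dR (residual dR T (W_ n w)))%R /\
  forall i, c * hnorm dR (residual dR T (W_ n w) (of_coords b (r i w))) <= tol].

Lemma loop_conditionN n w :
  ~ loop_condition dS dR b T tol eps (r^~ w) (s^~ w) n <->
  forall i, c * hnorm dR (residual dR T (W_ n w) (of_coords b (r i w))) <= tol.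
Proof.
have c0 := c_est_gt0; rewrite /loop_condition.
have -> : forall x : K, (tol < c * x) = ~~ (x <= tol / c).
  by move=> x; rewrite -ltNge ltr_pdivrMr// mulrC.
have t0 : 0 <= tol / c by rewrite divr_ge0// ltW.
split.
  by move=> /negP; rewrite negbK => /bigmax_leP[_ h] i;
    rewrite mulrC -ler_pdivlMr//; exact: h.
move=> h; apply/negP; rewrite negbK; apply/bigmax_leP; split=> // i _.
by rewrite ler_pdivlMr// mulrC.
Qed.

Section measurability.
Context d' (X : measurableType d') (sx : nat -> X -> E).
Hypothesis msx : forall k, measurable_fun setT (sx k).
Notation Wx n x := (range_space b T (sx^~ x) n).

Lemma measurable_passes n (y : X -> E) : measurable_fun setT y ->
  measurable [set x | c * hnorm dR (residual dR T (Wx n x) (of_coords b (y x))) <= tol].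
Proof.
move=> my; apply: measurable_le_set => //; apply: measurable_funM => //.
apply: measurable_hnorm; apply: vmeasurable_residual => //.
exact: vmeasurable_of_coords.
Qed.

Lemma measurable_residual_eq0 n (y : X -> S) : vmeasurable (fun x => T (y x)) ->
  measurable [set x | residual dR T (Wx n x) (y x) = 0].
Proof.
by move=> my; apply: (measurable_eq0 dR); exact: vmeasurable_residual.
Qed.

Lemma measurable_stalls_gen n (y : X -> E) : measurable_fun setT y ->
  measurable [set x | T (of_coords b (y x)) \in Wx n x /\
    exists j : 'I_(\dim {:S}), residual dR T (Wx n x) b`_j != 0].
Proof.
move=> my; rewrite (_ : [set x | _] =
    [set x | residual dR T (Wx n x) (of_coords b (y x)) = 0] `&`
    \bigcup_(j : 'I_(\dim {:S})) ~` [set x | residual dR T (Wx n x) b`_j = 0]).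
  apply: measurableI.
    by apply: measurable_residual_eq0; exact: vmeasurable_of_coords.
  apply: countable_bigcupT_measurable => [//|j]; apply: measurableC.
  by apply: (measurable_residual_eq0 n (y := fun=> b`_j)); exact: vmeasurable_cst.
apply/seteqP; split=> x /= [h1 [j h2]]; split.
- by apply/eqP; rewrite residualE orth_rest_eq0.
- by exists j => //=; exact/eqP.
- by rewrite -(orth_rest_eq0 dR) -residualE; apply/eqP.
- by exists j; apply/eqP.
Qed.

Lemma measurable_accepts_bad_gen n (y : 'I_n_t -> X -> E) :
  (forall i, measurable_fun setT (y i)) ->
  measurable [set x | (tol < opnorm dS dR (residual dR T (Wx n x)))%R /\
    forall i, c * hnorm dR (residual dR T (Wx n x) (of_coords b (y i x))) <= tol].
Proof.
move=> my; rewrite (_ : [set x | _] =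
    [set x | tol < opnorm dS dR (residual dR T (Wx n x))] `&`
    \bigcap_(i in [set: 'I_n_t]) [set x |
      c * hnorm dR (residual dR T (Wx n x) (of_coords b (y i x))) <= tol]).
  apply: measurableI; first by apply: measurable_opnorm_gt => //; exact: ltW.
  by apply: fin_bigcap_measurable => // i _; exact: measurable_passes.
apply/seteqP; split=> x /= [h1 h2]; split=> // i; first by move=> _; exact: h2.
exact: (h2 i).
Qed.

End measurability.

Lemma measurable_stalls n : measurable (stalls n).
Proof. exact: measurable_stalls_gen. Qed.

Lemma measurable_accepts_bad n : measurable (accepts_bad n).
Proof. exact: measurable_accepts_bad_gen. Qed.

Definition prefix_draws n : n.-tuple ('I_n_t + nat) :=
  map_tuple inr (iota_tuple n 0).

(** The draw of index [k] read off from the tuple of the first [n] draws; the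
    value for [n <= k] is a default, and [range_space] at [n] reads only the
    first [n] draws. *)
Definition coordinate n (Z : Type) (k : nat) (x : n.-tuple E * Z) : E :=
  nth (nseq_tuple _ 0) x.1 k.
Arguments coordinate {n Z} k x.

Lemma measurable_coordinate n d' (Z : measurableType d') k :
  measurable_fun setT (@coordinate n Z k).
Proof.
have [kn|nk] := ltnP k n.
  rewrite (_ : coordinate k = (fun t => tnth t (Ordinal kn)) \o fst); last first.
    by apply/funext => x; rewrite /coordinate /= (tnth_nth (nseq_tuple _ 0)).
  exact: measurableT_comp (measurable_tnth _) measurable_fst.
rewrite (_ : coordinate k = fun=> nseq_tuple _ 0); first exact: measurable_cst.
by apply/funext => x; rewrite /coordinate nth_default// size_tuple.
Qed.

Lemma coordinate_prefix n (Z : Type) (w : Omega) (z : Z) :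
  W_ n w =
    range_space b T (fun k => coordinate k (joint draws (prefix_draws n) w, z)) n.
Proof.
apply: eq_range_space => k kn; rewrite /coordinate /=.
rewrite (nth_map (Ordinal kn)) ?size_enum_ord//.
rewrite (tnth_nth (inr 0%N)) /= (nth_map 0%N) ?size_iota ?nth_enum_ord//.
by rewrite nth_iota.
Qed.

Lemma prefix_draws_uniq n m (J : m.-tuple ('I_n_t + nat)) : uniq J ->
  (forall k, (k < n)%N -> inr k \notin (J : seq _)) -> uniq (prefix_draws n ++ J).
Proof.
move=> uJ h; rewrite cat_uniq uJ andbT map_inj_uniq ?iota_uniq/=; last first.
  by move=> i j [].
apply/hasPn => x xJ; apply/negP => /mapP[k]; rewrite mem_iota => kn xE.
by have := h k kn; rewrite -xE xJ.
Qed.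

(** For fixed earlier draws this is [normal_vector_ker_null] applied to the
    residual. *)
Lemma stalls_null n : P (stalls n) = 0%E.
Proof.
pose C := [set x : n.-tuple E * 1.-tuple E |
  T (of_coords b (tnth x.2 ord0)) \in range_space b T (coordinate^~ x) n /\
  exists j : 'I_(\dim {:S}),
    residual dR T (range_space b T (coordinate^~ x) n) b`_j != 0].
have mC : measurable C.
  apply: (measurable_stalls_gen _ _ (y := fun x => tnth x.2 ord0)).
    by move=> k; exact: measurable_coordinate.
  exact: measurableT_comp (measurable_tnth _) measurable_snd.
apply/eqP; rewrite -measure_le0.
rewrite (_ : stalls n = [set w | C (joint draws (prefix_draws n) w,
    joint draws [tuple inr n] w)]); last first.
  by apply/seteqP; split=> w; rewrite /C /stalls /= -coordinate_prefix tnth_mktuple.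
apply: (joint_section_le measurable_draws draws_indep) => //.
  apply: prefix_draws_uniq => // k kn; rewrite inE; apply/eqP => -[kE].
  by rewrite kE ltnn in kn.
move=> t; rewrite /C /=.
pose W := range_space b T (fun k => nth (nseq_tuple _ 0) t k) n.
have [[j Wj]|noj] := pselect (exists j : 'I_(\dim {:S}), residual dR T W b`_j != 0);
    last first.
  rewrite (_ : [set w | _] = set0) ?measure0//.
  by apply/seteqP; split=> w //= [_ ej]; apply: noj.
rewrite (_ : [set w | _] = [set w | residual dR T W (of_coords b (s n w)) = 0]).
  rewrite le_eqVlt; apply/orP; left; apply/eqP.
  by apply: (normal_vector_ker_null dR) => //; exists j.
apply/seteqP; split=> w /=; rewrite tnth_mktuple.
  by move=> [h _]; apply/eqP; rewrite residualE orth_rest_eq0.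
move=> h; split; last by exists j.
by rewrite -(orth_rest_eq0 dR) -residualE; apply/eqP.
Qed.

(** For fixed earlier draws this is [all_tests_bound]. *)
Lemma accepts_bad_le n : (P (accepts_bad n) <= eps%:E)%E.
Proof.
pose C := [set x : n.-tuple E * n_t.-tuple E |
  (tol < opnorm dS dR (residual dR T (range_space b T (coordinate^~ x) n)))%R /\
  forall i, c * hnorm dR (residual dR T (range_space b T (coordinate^~ x) n)
    (of_coords b (tnth x.2 i))) <= tol].
have mC : measurable C.
  apply: (measurable_accepts_bad_gen _ _ (y := fun i x => tnth x.2 i)).
    by move=> k; exact: measurable_coordinate.
  by move=> i; exact: measurableT_comp (measurable_tnth _) measurable_snd.
pose J := map_tuple inl (ord_tuple n_t) : n_t.-tuple ('I_n_t + nat).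
have JE w i : tnth (joint draws J w) i = r i w.
  by rewrite tnth_mktuple tnth_map tnth_ord_tuple.
rewrite (_ : accepts_bad n = [set w | C (joint draws (prefix_draws n) w,
    joint draws J w)]); last first.
  apply/seteqP; split=> w; rewrite /C /accepts_bad /= -coordinate_prefix;
    by move=> [h1 h2]; split=> // i; have := h2 i; rewrite JE.
apply: (joint_section_le measurable_draws draws_indep) => //.
  apply: prefix_draws_uniq => [|k kn].
    by rewrite map_inj_uniq ?enum_uniq// => i j [].
  by apply/negP => /mapP[].
move=> t; rewrite /C /=.
pose W := range_space b T (fun k => nth (nseq_tuple _ 0) t k) n.
have [Wtol|Wtol] := ltP tol (opnorm dS dR (residual dR T W)); last first.
  rewrite (_ : [set w | _] = set0) ?measure0.
    by rewrite lee_fin; case/andP: eps01 => /ltW.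
  by apply/seteqP; split=> w //= [].
apply: le_trans (all_tests_bound Wtol).
rewrite (_ : [set w | _] = [set w | forall i,
   c * hnorm dR (residual dR T W (of_coords b (r i w))) <= tol])//.
apply/seteqP; split=> w /=; first by move=> [_ h] i; have := h i; rewrite JE.
by move=> h; split=> // i; rewrite JE.
Qed.

(** Each draw that does not stall enlarges the range space by one dimension, as
    long as it is not yet the range of [T]. *)
Lemma range_space_full w : (forall n, (n < \dim (limg T))%N -> ~ stalls n w) ->
  W_ (\dim (limg T)) w = limg T.
Proof.
move=> nst.
have step n : (n <= \dim (limg T))%N ->
    W_ n w = limg T \/ \dim (W_ n w) = n.
  elim: n => [_|n IH nT]; first by right; rewrite range_space0 dimv0.
  have sub : (W_ n w <= W_ n.+1 w)%VS.
    by rewrite range_spaceS; apply: sub_span => x xs; rewrite mem_rcons in_cons xs orbT.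
  have full : W_ n w = limg T -> W_ n.+1 w = limg T.
    by move=> e; apply/eqP; rewrite eqEsubv range_space_sub -{1}e.
  have [/full|dimn] := IH (ltnW nT); first by left.
  have [Tin|Tnin] := boolP (T (of_coords b (s n w)) \in W_ n w); last first.
    by right; rewrite dim_range_spaceS// dimn.
  left; apply: full; apply: (residual_basis_eq0 (dR := dR) b_basis).
    exact: range_space_sub.
  move=> j; apply/eqP; rewrite -[_ == _]negbK; apply/negP => nz.
  by apply: (nst n nT); split=> //; exists j.
have [//|dimT] := step _ (leqnn _).
by apply/eqP; rewrite eqEdim range_space_sub dimT leqnn.
Qed.

Definition loops n :=
  [set w | loop_condition dS dR b T tol eps (r^~ w) (s^~ w) n].

(** The complement of the event that the algorithm returns a space within the
    tolerance: it contains the runs that never stop. *)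
Definition no_good_return := [set w | forall n,
  (forall m, (m < n)%N -> loops m w) -> ~ loops n w ->
  tol < opnorm dS dR (residual dR T (W_ n w))].

Lemma measurable_loops n : measurable (loops n).
Proof.
rewrite (_ : loops n = ~` \bigcap_(i in [set: 'I_n_t]) [set w |
    c * hnorm dR (residual dR T (W_ n w) (of_coords b (r i w))) <= tol]).
  apply: measurableC; apply: fin_bigcap_measurable => // i _.
  exact: measurable_passes.
apply/seteqP; split=> w /=.
  move=> l h; suff : ~ loops n w by [].
  by apply/loop_conditionN => i; exact: h.
by move=> h; apply: contrapT => /loop_conditionN h'; apply: h => i _; exact: h'.
Qed.

Lemma measurable_no_good_return : measurable no_good_return.
Proof.
rewrite (_ : no_good_return = \bigcap_n (~` (\bigcap_(m in `I_n) loops m `&` ~` loops n)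
    `|` [set w | tol < opnorm dS dR (residual dR T (W_ n w))])); last first.
  apply/seteqP; split=> w /=.
    move=> h n _.
    have [[h1 h2]|h12] := pselect ((\bigcap_(m in `I_n) loops m `&` ~` loops n) w).
      by right; apply: h.
    by left.
  by move=> h n h1 h2; have [] := h n I => // h3; case: h3; split.
apply: bigcapT_measurable => n; apply: measurableU.
  apply: measurableC; apply: measurableI.
    by apply: bigcap_measurableType => m _; exact: measurable_loops.
  exact/measurableC/measurable_loops.
by apply: measurable_opnorm_gt => //; exact: ltW.
Qed.

(** If no stage below the rank stalls, the loop stops, at the latest when the
    range space is full.  Since the full space is within the tolerance, a run
    that returns nothing good stops earlier, by a wrong acceptance. *)
Lemma no_good_return_sub : no_good_return `<=`
  \big[setU/set0]_(n < \dim (limg T)) (stalls n `|` accepts_bad n).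
Proof.
move=> w bad; apply: contrapT => good.
have nst n : (n < \dim (limg T))%N -> ~ (stalls n `|` accepts_bad n) w.
  move=> nT h; apply: good.
  by rewrite -(bigcup_mkord _ (fun n => stalls n `|` accepts_bad n)); exists n.
have fullT : W_ (\dim (limg T)) w = limg T.
  by apply: range_space_full => n /nst h st; apply: h; left.
have opT : opnorm dS dR (residual dR T (W_ (\dim (limg T)) w)) <= 0.
  by rewrite fullT residual_limg (opnorm0 _ _ b_basis S_gt0).
have stop : ~ loops (\dim (limg T)) w.
  apply/loop_conditionN => i; rewrite fullT residual_limg zero_lfunE hnorm0 mulr0.
  exact: ltW.
have ex : exists n, `[< ~ loops n w >] by exists (\dim (limg T)); apply/asboolP.
case: (ex_minnP ex) => n /asboolP nstop nmin.
have nT : (n <= \dim (limg T))%N by apply: nmin; apply/asboolP.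
have wn : tol < opnorm dS dR (residual dR T (W_ n w)).
  apply: bad => // m mn; apply: contrapT => /asboolP /nmin.
  by rewrite leqNgt mn.
move: nT; rewrite leq_eqVlt => /predU1P[nE|/nst h].
  by move: wn; rewrite nE ltNge (le_trans opT)// ltW.
by apply: h; right; split=> //; apply/loop_conditionN.
Qed.

Lemma no_good_return_le : (P no_good_return <= ((\dim (limg T))%:R * eps)%:E)%E.
Proof.
have mU n : measurable (stalls n `|` accepts_bad n).
  by apply: measurableU; [exact: measurable_stalls|exact: measurable_accepts_bad].
apply: le_trans (le_measure P _ _ no_good_return_sub) _; rewrite ?inE.
- exact: measurable_no_good_return.
- by apply: bigsetU_measurable => n _.
apply: (le_trans
  (Boole_inequality (A := fun n => stalls n `|` accepts_bad n) P _)) => [//|].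
apply: (@le_trans _ _ (\sum_(n < \dim (limg T)) eps%:E)%E).
  apply: lee_sum => n _.
  apply: (@le_trans _ _ (P (stalls n) + P (accepts_bad n))%E).
    by apply: measureU2; [exact: measurable_stalls|exact: measurable_accepts_bad].
  by rewrite stalls_null add0e accepts_bad_le.
by rewrite sumEFin sumr_const card_ord mulr_natl.
Qed.

End failure.

Theorem mainTheorem4 (K : realType) (S R : vectType K)
    (dS : {dot S for idfun}) (dR : {dot R for idfun})
    (b : (\dim {:S}).-tuple S) (b_basis : basis_of {:S} b)
    (T : 'Hom(S, R)) (N_T : nat) (rankT : \dim (limg T) = N_T)
    (N_T_ge1 : (1 <= N_T)%N)
    (tol : K) (tol_gt0 : 0 < tol) (n_t : nat) (n_t_ge1 : (1 <= n_t)%N)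
    (eps_algofail : K) (eps_gt0 : 0 < eps_algofail) (eps_lt1 : eps_algofail < 1)
    (eps_testfail : K) (eps_testfailE : eps_testfail = eps_algofail / N_T%:R)
    (d : measure_display) (Omega : measurableType d) (P : probability Omega K)
    (r : 'I_n_t -> {RV P >-> (\dim {:S}).-tuple K})
    (s : nat -> {RV P >-> (\dim {:S}).-tuple K})
    (r_normal : forall i, random_normal_vector (r i))
    (s_normal : forall k, random_normal_vector (s k))
    (rs_indep : mutually_independent P
       (fun k : 'I_n_t + nat =>
          match k return Omega -> (\dim {:S}).-tuple K with
          | inl i => r i
          | inr j => s j
          end)) :
  (P [set w | forall W : {vspace R},
        returns dS dR b T tol eps_algofail (r^~ w) (s^~ w) W ->
        (tol < opnorm dS dR (residual dR T W))%R]
     <= (N_T%:R * eps_testfail)%:E)%E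
  /\ N_T%:R * eps_testfail = eps_algofail.
Proof.
have N0 : 0 < N_T%:R :> K by rewrite ltr0n.
split; last by rewrite eps_testfailE mulrC divfK// gt_eqF.
have eps01 : 0 < eps_testfail < 1.
  rewrite eps_testfailE divr_gt0//= ltr_pdivrMr// mul1r (lt_le_trans eps_lt1)//.
  by rewrite ler1n.
have T_rank : (0 < \dim (limg T))%N by rewrite rankT.
have := @no_good_return_le K S R dS dR b b_basis T T_rank tol n_t tol_gt0 n_t_ge1
  eps_testfail eps01 d Omega P r s r_normal s_normal rs_indep.
rewrite rankT; congr (P _ <= _)%E; apply/seteqP; split=> w /=.
  move=> h W; rewrite /returns rankT -eps_testfailE => -[n [h1 h2 ->]].
  exact: h.
move=> h n h1 h2; apply: h; rewrite /returns rankT -eps_testfailE.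
by exists n; split.
Qed.
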